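(* Let $k \geq 3$ be an integer. Then (i) $\mathrm{OPT}_k(C_5) = \frac{1}{k^4}\left(12k^4 - 60k^3 + 120k^2 - 120k + 48\right)$. (ii) If $n$ is sufficiently large (depending on $k$), then $T_k(n)$ is the unique (up to isomorphism) $K_{k+1}$-free graph on $n$ vertices that attains $\mathrm{ex}(n,C_5,K_{k+1})$; that is, $\nu(C_5,T_k(n)) = \mathrm{ex}(n,C_5,K_{k+1})$, and every $K_{k+1}$-free graph $G$ on $n$ vertices with $\nu(C_5,G) = \mathrm{ex}(n,C_5,K_{k+1})$ is isomorphic to $T_k(n)$.
   Context: All graphs are finite and simple. $C_5$ is the cycle on five vertices and $K_{k+1}$ is the complete graph on $k+1$ vertices. For graphs $H$ and $G$, $\nu(H,G)$ is the number of (not necessarily induced) subgraphs of $G$ isomorphic to $H$. A graph is $F$-free if it contains no (not necessarily induced) subgraph isomorphic to $F$. $\mathrm{ex}(n,H,F)$ is the maximum of $\nu(H,G)$ over all $F$-free graphs $G$ on $n$ vertices. For graphs $H$, $G$ on $n_1$, $n_2$ vertices respectively, the density is $d(H,G) = \nu(H,G)\binom{n_2}{n_1}^{-1}$ (this can exceed $1$). Define $\mathrm{OPT}_k(C_5) = \lim_{n\to\infty} \max_{G} d(C_5,G)$, where the maximum is over all $K_{k+1}$-free graphs $G$ on $n$ vertices. The Turán graph $T_k(n)$ is the complete $k$-partite graph on $n$ vertices whose partite set sizes pairwise differ by at most one. *)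

(* Defs.v *)
From HB Require Import structures.
From mathcomp Require Import all_boot all_order all_algebra.
From mathcomp Require Import zify.
From mathcomp Require Import all_classical all_reals all_analysis.
Set Implicit Arguments.
Unset Strict Implicit.
Unset Printing Implicit Defensive.
Import Order.TTheory GRing.Theory Num.Theory.
Import numFieldNormedType.Exports.

Local Open Scope nat_scope.

(* A finite simple graph on the vertex type V: its edges are unordered pairs
   of distinct vertices. *)
Record sgraph (V : finType) := SGraph {
  edges : {set {set V}};
  _ : [forall e in edges, #|e| == 2] }.

HB.instance Definition _ (V : finType) := [isSub for @edges V].
HB.instance Definition _ (V : finType) := [Finite of sgraph V by <:].

Definition isomorphic (V W : finType) (G : sgraph V) (H : sgraph W) : Prop :=
  exists2 f : V -> W, bijective f &
    edges H = [set [set f x | x in e] | e : {set V} in edges G]%SET.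

(* A pair S = (vertex set, edge set) is a subgraph of G. *)
Definition is_subgraph (V : finType) (G : sgraph V)
    (S : {set V} * {set {set V}}) : bool :=
  (S.2 \subset edges G) && [forall e in S.2, e \subset S.1].

(* H is isomorphic to the graph S = (vertex set, edge set): some injection
   has image S.1 and carries the edges of H exactly onto S.2. *)
Definition iso_to_subgraph (U V : finType) (H : sgraph U)
    (S : {set V} * {set {set V}}) : bool :=
  [exists f : {ffun U -> V},
    [&& injectiveb f, [set f x | x : U]%SET == S.1
      & [set [set f x | x in e] | e : {set U} in edges H]%SET == S.2]].

Definition copies (U V : finType) (H : sgraph U) (G : sgraph V)
    : {set {set V} * {set {set V}}} :=
  [set S | is_subgraph G S && iso_to_subgraph H S]%SET.

Definition nu (U V : finType) (H : sgraph U) (G : sgraph V) : nat :=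
  #|copies H G|.

Definition Ffree (U V : finType) (F : sgraph U) (G : sgraph V) : bool :=
  copies F G == finset.set0.

(* Graphs on n vertices are taken on 'I_n. The value is 0 if no graph on n
   vertices is F-free. *)
Definition extremal (U W : finType) (n : nat) (H : sgraph U) (F : sgraph W) : nat :=
  \max_(G : sgraph 'I_n | Ffree F G) nu H G.

Lemma complete_subproof n :
  [forall e in [set e : {set 'I_n} | #|e| == 2]%SET, #|e| == 2].
Proof. by apply/forall_inP => e; rewrite inE. Qed.

Definition complete (n : nat) : sgraph 'I_n := SGraph (complete_subproof n).

(* ordS is the successor modulo 5. *)
Lemma C5_subproof :
  [forall e in [set [set i; ordS i] | i : 'I_5]%SET, #|e| == 2].
Proof.
apply/forall_inP => e /imsetP[i _ ->]; rewrite cards2.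
by case: i => [[|[|[|[|[|]]]]]].
Qed.

Definition C5 : sgraph 'I_5 := SGraph C5_subproof.

(* The complete multipartite graph whose partite sets are the fibres of c. *)
Lemma complete_multipartite_subproof (V : finType) (P : eqType) (c : V -> P) :
  [forall e in [set [set x; y] | x in V, y in V & c x != c y]%SET, #|e| == 2].
Proof.
apply/forall_inP => e /imset2P[x y _ + ->]; rewrite inE /= => cxy.
by rewrite cards2 (contraNneq _ cxy) // => ->.
Qed.

Definition complete_multipartite (V : finType) (P : eqType) (c : V -> P)
    : sgraph V := SGraph (complete_multipartite_subproof c).

(* The partite sets of the Turan graph are the residue classes mod k in
   {0, ..., n-1}; turan_balanced shows that their sizes pairwise differ by at
   most one. *)
Definition turan (k n : nat) : sgraph 'I_n :=
  complete_multipartite (fun i : 'I_n => i %% k).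

Lemma card_residue_class k n r : r < k ->
  #|[set i : 'I_n | i %% k == r]%SET| = (n + (k.-1 - r)) %/ k.
Proof.
move=> rk; have k0 : 0 < k by apply: leq_ltn_trans rk.
rewrite cardsE -sum1_card big_mkcond /= -(big_mkord xpredT
  (fun i => if i %% k == r then 1 else 0)) /=.
elim: n => [|n IH].
  by rewrite big_geq // add0n divn_small // -subn1; lia.
rewrite big_nat_recr //= {}IH.
have := divn_eq n k; have := ltn_pmod n k0.
set q := n %/ k; set s := n %% k => sk nE.
have -> : n + (k.-1 - r) = q * k + (s + (k.-1 - r)) by lia.
have -> : n.+1 + (k.-1 - r) = q * k + (s.+1 + (k.-1 - r)) by lia.
rewrite !divnMDl // -addnA; congr (_ + _).
case: eqP => [->|/eqP nsr].
  rewrite divn_small; last by lia.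
  by have -> : r.+1 + (k.-1 - r) = k by [lia]; rewrite divnn k0.
rewrite addn0; case: (ltnP s r) => srr.
  by rewrite !divn_small //; lia.
have {1}-> : s + (k.-1 - r) = 1 * k + (s - r.+1) by lia.
have -> : s.+1 + (k.-1 - r) = 1 * k + (s - r) by lia.
by rewrite !divnMDl // !divn_small //; lia.
Qed.

Lemma turan_balanced k n r s : r < k -> s < k ->
  #|[set i : 'I_n | i %% k == r]%SET| <= #|[set i : 'I_n | i %% k == s]%SET|.+1.
Proof.
move=> rk sk; have k0 : 0 < k by apply: leq_ltn_trans rk.
rewrite !card_residue_class //.
apply: (@leq_trans ((n + (k.-1 - s) + k) %/ k)); first by apply: leq_div2r; lia.
by rewrite divnDr // divnn k0 addn1.
Qed.

Local Open Scope ring_scope.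

Definition density (R : realType) (U V : finType) (H : sgraph U) (G : sgraph V)
    : R := (nu H G)%:R / ('C(#|V|, #|U|))%:R.

(* Densities are nonnegative, so the default value 0 does not affect the
   maximum. *)
Definition max_density (R : realType) (U : finType) (k : nat) (H : sgraph U)
    (n : nat) : R :=
  \big[Num.max/0]_(G : sgraph 'I_n | Ffree (complete k.+1) G) density R H G.

(* limn is a junk value on divergent sequences; assert convergence of
   max_density separately. *)
Definition OPT (R : realType) (U : finType) (k : nat) (H : sgraph U) : R :=
  limn (max_density R k H).

(* Main.v *)
(** Let [A] be the adjacency matrix of a [K_{k+1}]-free graph on [n] vertices, [D = (1 - 1/k) n],
    and [B = A^2 + (n/k) A], which has nonnegative entries. The Motzkin-Straus inequality gives
    [b A b^T <= D |b|^2] for each row [b] of [B]; summing over the rows,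

      [tr A^5 <= ((k-3)/k) n |B|^2 + 3 (n/k)^2 tr A^3 + 2 (n/k)^3 tr A^2].

    Each term on the right is at most its value at a balanced complete [k]-partite graph,
    by the bounds [sum d <= D n] and [sum d^2 <= D^2 n], applied to the graph and to its
    neighbourhoods. Since [10 nu(C5, G) = tr A^5 - 5 sum_v d(v) (A^3)_vv + 5 tr A^3], this
    gives the limit.

    The coefficient of [tr A^2] provides a slack of order [n^3 X], where [X = D n - tr A^2] is
    the deficiency in edges, while the degenerate walks only gain [O(n^2 X + n^3)]. Hence
    [X = O(1)] for an extremal graph. By Furedi's argument such a graph is, up to [O(1)] pairs,
    complete [k]-partite with large parts, and an edge inside a part would create [K_{k+1}].
    So an extremal graph is complete [k]-partite, and moving a vertex from a part to one
    smaller by at least two strictly increases the number of pentagons. *)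

Require Import Defs.
From mathcomp Require Import all_boot all_order all_algebra all_fingroup.
From mathcomp Require Import ring lra zify.
Set Implicit Arguments.
Unset Strict Implicit.
Unset Printing Implicit Defensive.
Import Order.TTheory GRing.Theory Num.Theory.

(** * Cliques and the Motzkin-Straus inequality *)

Local Open Scope ring_scope.

Definition clique (V : finType) (e : rel V) (C : {set V}) : bool :=
  [forall x in C, forall y in C, (x != y) ==> e x y].

Definition clique_free (V : finType) (e : rel V) (m : nat) (S : {set V}) : bool :=
  [forall C : {set V}, (C \subset S) ==> clique e C ==> (#|C| < m)%N].

Lemma cliqueP (V : finType) (e : rel V) (C : {set V}) :
  reflect {in C &, forall x y, x != y -> e x y} (clique e C).
Proof.
apply: (iffP forall_inP) => [h x y xC yC|h x xC].
  by move/forall_inP: (h x xC) => /(_ y yC) /implyP.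
by apply/forall_inP => y yC; apply/implyP; apply: h.
Qed.

Lemma clique_freeP (V : finType) (e : rel V) (m : nat) (S : {set V}) :
  reflect (forall C : {set V}, C \subset S -> clique e C -> (#|C| < m)%N)
          (clique_free e m S).
Proof.
apply: (iffP forallP) => [h C CS Ccl|h C].
  by move/implyP: (h C) => /(_ CS) /implyP; apply.
by apply/implyP => CS; apply/implyP; apply: h.
Qed.

Lemma clique_freeS (V : finType) (e : rel V) m (S S' : {set V}) :
  S' \subset S -> clique_free e m S -> clique_free e m S'.
Proof.
move=> sub /clique_freeP h; apply/clique_freeP => C CS'.
exact/h/(subset_trans CS').
Qed.

Lemma eq_ler (R : numDomainType) (x y : R) : x = y -> x <= y.
Proof. by move->. Qed.

Section QuadraticForms.
Variables (R : realFieldType) (V : finType).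

(** Cauchy-Schwarz: the gap between the two sides is half of [\sum_(u in S) \sum_(v in S) (y u - y
    v) ^+ 2]. *)
Lemma sqr_sum_le (S : {set V}) (y : V -> R) :
  (\sum_(u in S) y u) ^+ 2 <= #|S|%:R * \sum_(u in S) y u ^+ 2.
Proof.
have h : 0 <= \sum_(u in S) \sum_(v in S) (y u - y v) ^+ 2.
  by apply: sumr_ge0 => u _; apply: sumr_ge0 => v _; rewrite sqr_ge0.
have eq : \sum_(u in S) \sum_(v in S) (y u - y v) ^+ 2 =
    2 * (#|S|%:R * \sum_(u in S) y u ^+ 2) - 2 * (\sum_(u in S) y u) ^+ 2.
  under eq_bigr => u _.
    under eq_bigr => v _.
      have -> : (y u - y v) ^+ 2 = y u ^+ 2 + y v ^+ 2 + - (2 * y u) * y v by ring.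
      over.
    rewrite !big_split /= sumr_const -mulr_sumr -[X in X + _ + _]mulr_natl.
    over.
  rewrite !big_split /= sumr_const -mulr_sumr -mulr_natl -mulr_suml sumrN -mulr_sumr.
  by ring.
lra.
Qed.

Variable e : rel V.
Hypotheses (esym : symmetric e) (eirr : irreflexive e).

Definition adj (u v : V) : R := (e u v)%:R.

Lemma adjC u v : adj u v = adj v u. Proof. by rewrite /adj esym. Qed.
Lemma adjuu u : adj u u = 0. Proof. by rewrite /adj eirr. Qed.
Lemma adj_ge0 u v : 0 <= adj u v. Proof. exact: ler0n. Qed.
Lemma adj_le1 u v : adj u v <= 1. Proof. by rewrite /adj; case: (e u v); rewrite ?ler01. Qed.
Lemma adjM u v : adj u v * adj u v = adj u v.
Proof. by rewrite /adj; case: (e u v); rewrite ?mulr1 ?mulr0. Qed.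

Definition quad (S : {set V}) (y : V -> R) : R :=
  \sum_(u in S) \sum_(v in S) y u * adj u v * y v.

Lemma quad_setD1 (S : {set V}) (y : V -> R) u : u \in S ->
  quad S y = quad (S :\ u) y + 2 * y u * \sum_(w in S :\ u) adj u w * y w.
Proof.
move=> uS; rewrite /quad (big_setD1 u uS) /= (big_setD1 u uS) /= adjuu mulr0 mul0r add0r.
under [X in _ + X = _]eq_bigr => v _ do rewrite (big_setD1 u uS) /=.
rewrite big_split /= addrA [RHS]addrC; congr (_ + _).
rewrite -[2]/(1 + 1) mulrDl mul1r mulrDl mulr_sumr; congr (_ + _).
  by apply: eq_bigr => w _; rewrite mulrA.
by apply: eq_bigr => w _; rewrite (adjC u w); ring.
Qed.

Lemma eq_quad (S : {set V}) (y z : V -> R) : {in S, y =1 z} -> quad S y = quad S z.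
Proof.
by move=> h; apply: eq_bigr => u uS; apply: eq_bigr => v vS; rewrite !h.
Qed.

(** Induction on [#|S|]. On a clique the inequality is Cauchy-Schwarz with [#|S| <= k]. Otherwise
    two vertices of [S] are nonadjacent; the form is linear in the weight shifted from one to the
    other, so one of them can be emptied and dropped without decreasing it. *)
Lemma motzkin_straus k (S : {set V}) (y : V -> R) :
  (0 < k)%N -> clique_free e k.+1 S -> {in S, forall u, 0 <= y u} ->
  quad S y <= (1 - k%:R^-1) * (\sum_(u in S) y u) ^+ 2.
Proof.
move=> k0; have kR : 0 < k%:R :> R by rewrite ltr0n.
have [m] := ubnP #|S|; elim: m S y => // m IH S y /ltnSE Sm Sfree y0.
have [Scl|] := boolP (clique e S).
  have Sk : (#|S| <= k)%N by move/clique_freeP: Sfree => /(_ S (subxx _) Scl).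
  have -> : quad S y = (\sum_(u in S) y u) ^+ 2 - \sum_(u in S) y u ^+ 2.
    rewrite expr2 mulr_suml -sumrB; apply: eq_bigr => u uS.
    rewrite mulr_sumr !(big_setD1 u uS) /= adjuu mulr0 mul0r add0r.
    rewrite -expr2 addrAC subrr add0r; apply: eq_bigr => v; rewrite !inE => /andP[vu vS].
    by rewrite /adj (cliqueP _ _ Scl) ?mulr1 // eq_sym.
  rewrite mulrBl mul1r lerD2l lerN2 mulrC ler_pdivrMr //.
  apply: le_trans (sqr_sum_le S y) _; rewrite mulrC ler_wpM2l ?ler_nat //.
  by apply: sumr_ge0 => u _; rewrite sqr_ge0.
rewrite negb_forall => /existsP[u]; rewrite negb_imply => /andP[uS].
rewrite negb_forall => /existsP[v]; rewrite !negb_imply => /and3P[vS uv euv].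
(* [h w] is the weight of the neighbours of [w] other than [u] and [v]. By symmetry [v] has the
   heavier neighbourhood, and moving the weight of [u] onto [v] then gains
   [2 * y u * (h v - h u)]. *)
pose h w := \sum_(x in S :\ u :\ v) adj w x * y x.
wlog huv : u v uS vS uv euv @h / h u <= h v.
  move=> W; have [|/ltW] := lerP (h u) (h v); first exact: (W u v).
  rewrite /h setDDl setUC -setDDl => hvu.
  by apply: (W v u) => //; rewrite 1?eq_sym // esym.
have vSu : v \in S :\ u by rewrite !inE eq_sym uv.
have auv : adj u v = 0 by rewrite /adj (negbTE euv).
pose z w := if w == v then y v + y u else y w.
have zy : {in S :\ u :\ v, z =1 y}.
  by move=> w; rewrite !inE /z => /andP[/negbTE ->].
have sumz : \sum_(w in S :\ u) z w = \sum_(w in S) y w.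
  rewrite (big_setD1 v vSu) [RHS](big_setD1 u uS) /= (big_setD1 v vSu) /=.
  by rewrite (eq_bigr _ zy) /z eqxx; ring.
have le1 : quad S y <= quad (S :\ u) z.
  rewrite (quad_setD1 _ uS) (quad_setD1 _ vSu) (quad_setD1 z vSu) (eq_quad zy).
  rewrite (big_setD1 v vSu) /= auv mul0r add0r -/(h u) -/(h v).
  have -> : \sum_(w in S :\ u :\ v) adj v w * z w = h v.
    by apply: eq_bigr => w wS; rewrite zy.
  rewrite {1}/z eqxx -subr_ge0.
  have -> : quad (S :\ u :\ v) y + 2 * (y v + y u) * h v -
     (quad (S :\ u :\ v) y + 2 * y v * h v + 2 * y u * h u)
     = 2 * y u * (h v - h u) by ring.
  by rewrite !mulr_ge0 ?y0 // subr_ge0.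
apply: le_trans le1 _; rewrite -sumz; apply: IH.
- by rewrite (cardsD1 u S) uS in Sm.
- exact: clique_freeS (subsetDl _ _) Sfree.
- move=> w; rewrite !inE /z => /andP[_ wS].
  by case: ifP => _; rewrite ?addr_ge0 ?y0.
Qed.

End QuadraticForms.

(** * Spectral bounds for clique-free graphs *)

Section SpectralBounds.
Variables (R : realFieldType) (V : finType).
Variable e : rel V.
Hypotheses (esym : symmetric e) (eirr : irreflexive e).
Local Notation adj := (adj R e).
Local Notation quad := (@quad R V e).

Section InSet.
Variables (k : nat) (S : {set V}).
Hypotheses (k0 : (0 < k)%N) (Sfree : clique_free e k.+1 S).
Local Notation L := ((1 - k%:R^-1) * #|S|%:R : R).

Lemma one_subV_ge0 : 0 <= 1 - k%:R^-1 :> R.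
Proof. by rewrite subr_ge0 invf_le1 ?ltr0n // ler1n. Qed.

(** Wilf's bound on the spectral radius. Taking absolute values of [y] makes Motzkin-Straus
    applicable, and Cauchy-Schwarz then bounds the squared sum. *)
Lemma quad_norm_le (y : V -> R) : `|quad S y| <= L * \sum_(u in S) y u ^+ 2.
Proof.
have h1 : `|quad S y| <= quad S (fun u => `|y u|).
  apply: le_trans (ler_norm_sum _ _ _) _; apply: ler_sum => u _.
  apply: le_trans (ler_norm_sum _ _ _) _; apply: ler_sum => v _.
  by rewrite !normrM [`|adj _ _|]ger0_norm ?adj_ge0.
apply: le_trans h1 _; apply: le_trans (motzkin_straus esym eirr k0 Sfree _) _ => //.
rewrite -mulrA ler_wpM2l ?one_subV_ge0 //.
apply: le_trans (sqr_sum_le _ _) _.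
by under eq_bigr do rewrite real_normK ?num_real //.
Qed.

Lemma quad_le (y : V -> R) : quad S y <= L * \sum_(u in S) y u ^+ 2.
Proof. by have := quad_norm_le y; rewrite ler_norml => /andP[]. Qed.

Lemma quad_ge (y : V -> R) : - (L * \sum_(u in S) y u ^+ 2) <= quad S y.
Proof. by have := quad_norm_le y; rewrite ler_norml => /andP[]. Qed.

(** The vertex [u] is not confined to [S]: when [S] is the neighbourhood of some [v], this is the
    codegree of [u] and [v]. *)
Definition deg_in (u : V) : R := \sum_(w in S) adj u w.

(** On [S] the vector [deg_in] is $A 1$, so that $1^T A 1$ and $1^T A^2 1$ are the first two degree
    moments. This serves the test vectors $(a + b A) 1$ below. *)
Lemma quad_affine (a b : R) :
  quad S (fun u => a + b * deg_in u) =
  a ^+ 2 * (\sum_(u in S) deg_in u) + 2 * a * b * (\sum_(u in S) deg_in u ^+ 2)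
  + b ^+ 2 * quad S deg_in.
Proof.
have split2 (f g : V -> R) c : \sum_(u in S) \sum_(v in S) c * (f u * adj u v * g v) =
    c * \sum_(u in S) \sum_(v in S) f u * adj u v * g v.
  by rewrite mulr_sumr; apply: eq_bigr => u _; rewrite mulr_sumr.
rewrite /quad.
have -> : \sum_(u in S) \sum_(v in S) (a + b * deg_in u) * adj u v * (a + b * deg_in v) =
  \sum_(u in S) \sum_(v in S) (a ^+ 2 * (1 * adj u v * 1)) +
  \sum_(u in S) \sum_(v in S) ((a * b) * (deg_in u * adj u v * 1)) +
  \sum_(u in S) \sum_(v in S) ((a * b) * (1 * adj u v * deg_in v)) +
  \sum_(u in S) \sum_(v in S) (b ^+ 2 * (deg_in u * adj u v * deg_in v)).
  rewrite -!big_split; apply: eq_bigr => u _; rewrite -!big_split.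
  by apply: eq_bigr => v _ /=; ring.
rewrite !split2.
have -> : \sum_(u in S) \sum_(v in S) 1 * adj u v * 1 = \sum_(u in S) deg_in u.
  by apply: eq_bigr => u _; apply: eq_bigr => v _; rewrite mul1r mulr1.
have e1 : \sum_(u in S) \sum_(v in S) deg_in u * adj u v * 1 = \sum_(u in S) deg_in u ^+ 2.
  apply: eq_bigr => u _; rewrite expr2 {3}/deg_in mulr_sumr.
  by apply: eq_bigr => v _; rewrite mulr1.
have -> : \sum_(u in S) \sum_(v in S) 1 * adj u v * deg_in v = \sum_(u in S) deg_in u ^+ 2.
  rewrite -e1 exchange_big; apply: eq_bigr => u _; apply: eq_bigr => v _.
  by rewrite adjC //; ring.
rewrite e1; ring.
Qed.

Lemma sum_sqr_affine (f : V -> R) (a b : R) :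
  \sum_(u in S) (a + b * f u) ^+ 2 =
  #|S|%:R * a ^+ 2 + 2 * a * b * (\sum_(u in S) f u) + b ^+ 2 * (\sum_(u in S) f u ^+ 2).
Proof.
rewrite !mulr_sumr mulr_natl -sumr_const -!big_split /=.
by apply: eq_bigr => u _; ring.
Qed.

(** Turan's edge bound: Motzkin-Straus at the all-ones vector. *)
Lemma sum_deg_in_le : \sum_(u in S) deg_in u <= L * #|S|%:R.
Proof.
have := motzkin_straus esym eirr k0 Sfree (y := fun=> 1 : R) (fun _ _ => ler01).
rewrite /quad sumr_const -mulrA -expr2.
suff -> : \sum_(u in S) \sum_(v in S) 1 * adj u v * 1 = \sum_(u in S) deg_in u by [].
by apply: eq_bigr => u _; apply: eq_bigr => v _; rewrite mul1r mulr1.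
Qed.

(* For [l] bounding the spectral radius, [2l(l^2 - A^2)] is
   [(l - A)(l + A)(l - A) + (l + A)(l - A)(l + A)], which is positive semidefinite. *)
Lemma sum_sqr_deg_in_le : (1 < k)%N ->
  \sum_(u in S) deg_in u ^+ 2 <= L ^+ 2 * #|S|%:R.
Proof.
move=> k1; have [->|S0] := eqVneq S set0.
  by rewrite big_set0 cards0 mulr0.
have l0 : 0 < L.
  rewrite mulr_gt0 ?ltr0n ?card_gt0 // subr_gt0 invf_lt1 ?ltr0n ?ltr1n //.
(* The test vectors are $(l - A) 1$ and $(l + A) 1$. In the sum of the two inequalities the first
   and third moments cancel. *)
have := quad_ge (fun u => L + -1 * deg_in u).
have := quad_le (fun u => L + 1 * deg_in u).
rewrite !sum_sqr_affine !quad_affine.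
move: l0; set l := L; set D := \sum_(u in S) deg_in u; set W := \sum_(u in S) _ ^+ 2.
set n := #|S|%:R; set q := quad _ _ => l0 h1 h2.
have l2 : 0 < 2 * l by rewrite mulr_gt0.
by rewrite -subr_ge0 -(pmulr_rge0 _ l2); move: h1 h2; lra.
Qed.

End InSet.
End SpectralBounds.

(** * Closed walks in clique-free graphs *)

Definition nbr (V : finType) (e : rel V) (v : V) : {set V} := [set w | e v w].

(** A clique among the neighbours of [v] can be enlarged by [v]. *)
Lemma clique_free_nbr (V : finType) (e : rel V) (m : nat) (S : {set V}) v :
  symmetric e -> irreflexive e -> v \in S ->
  clique_free e m.+1 S -> clique_free e m (S :&: nbr e v).
Proof.
move=> esym eirr vS /clique_freeP h; apply/clique_freeP => C CS Ccl.
have vC : v \notin C.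
  by apply/negP => /(subsetP CS); rewrite !inE eirr andbF.
have := h (v |: C); rewrite cardsU1 vC add1n ltnS; apply.
  by rewrite subUset sub1set vS; apply: subset_trans CS (subsetIl _ _).
have evC x : x \in C -> e v x by move=> /(subsetP CS); rewrite !inE => /andP[].
apply/cliqueP => x y /setU1P[->|xC] /setU1P[->|yC]; rewrite ?eqxx //.
- by move=> _; apply: evC.
- by move=> _; rewrite esym evC.
- exact: (cliqueP _ _ Ccl).
Qed.

Section Walks.
Variables (R : realFieldType) (V : finType).
Variable e : rel V.
Hypotheses (esym : symmetric e) (eirr : irreflexive e).
Local Notation adj := (adj R e).
Local Notation quad := (@quad R V e).
Local Notation n := (#|V|%:R : R).

Definition deg (u : V) : R := \sum_w adj u w.
Definition codeg (u v : V) : R := \sum_w adj u w * adj w v.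
Definition walk3 (u v : V) : R := \sum_w codeg u w * adj w v.

Lemma sum_setT (f : V -> R) : \sum_(u in [set: V]) f u = \sum_u f u.
Proof. by apply: eq_bigl => u; rewrite inE. Qed.

Lemma codegC u v : codeg u v = codeg v u.
Proof. by rewrite /codeg; apply: eq_bigr => w _; rewrite mulrC !(adjC R esym w). Qed.

Lemma codeg_ge0 u v : 0 <= codeg u v.
Proof. by apply: sumr_ge0 => w _; rewrite mulr_ge0 ?adj_ge0. Qed.

Lemma degE v : deg v = #|nbr e v|%:R.
Proof.
rewrite /deg -sum1_card natr_sum [RHS]big_mkcond /=; apply: eq_bigr => w _.
by rewrite inE /adj; case: (e v w).
Qed.

Lemma sum_nbr v (f : V -> R) : \sum_(w in nbr e v) f w = \sum_w adj v w * f w.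
Proof.
rewrite big_mkcond; apply: eq_bigr => w _; rewrite inE /adj.
by case: (e v w); rewrite ?mul1r ?mul0r.
Qed.

Lemma codegE v u : codeg v u = deg_in R e (nbr e v) u.
Proof. by rewrite /deg_in sum_nbr; apply: eq_bigr => w _; rewrite (adjC R esym w). Qed.

Lemma sum_nbrC v (f : V -> R) :
  \sum_u f u = \sum_(u in nbr e v) f u + \sum_(u in ~: nbr e v) f u.
Proof.
rewrite (bigID (mem (nbr e v))) /=; congr (_ + _).
by apply: eq_bigl => w; rewrite !inE.
Qed.

(** Inclusion-exclusion: the number of vertices adjacent to neither [u] nor [v] is nonnegative. *)
Lemma codeg_ge u v : deg u + deg v - n <= codeg u v.
Proof.
have : 0 <= \sum_w (1 - adj u w) * (1 - adj w v).
  by apply: sumr_ge0 => w _; rewrite mulr_ge0 // subr_ge0 adj_le1.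
have -> : \sum_w (1 - adj u w) * (1 - adj w v) = \sum_(w : V) 1 + codeg u v - deg u - deg v.
  rewrite /codeg /deg -!sumrN -!big_split /=.
  by apply: eq_bigr => w _; rewrite (adjC R esym v); ring.
rewrite sumr_const; lra.
Qed.

Section CliqueFree.
Variable k : nat.
Hypotheses (k3 : (2 < k)%N) (Gfree : clique_free e k.+1 [set: V]).
Local Notation D := ((1 - k%:R^-1) * n : R).

Let k0 : (0 < k)%N. Proof. by apply: leq_trans k3. Qed.
Let k1 : (0 < k.-1)%N. Proof. by case: k k3 => [|[]]. Qed.
Let kR : k%:R != 0 :> R. Proof. by rewrite pnatr_eq0 -lt0n. Qed.
Let k3R : 3 <= k%:R :> R. Proof. by rewrite ler_nat. Qed.
Let predk : k.-1%:R = k%:R - 1 :> R.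
Proof. by rewrite -subn1 natrB. Qed.

Lemma nbr_free v : clique_free e k.-1.+1 (nbr e v).
Proof.
have := clique_free_nbr esym eirr (in_setT v) Gfree; rewrite setTI.
by rewrite prednK.
Qed.

Lemma sum_deg_le : \sum_u deg u <= D * n.
Proof.
have := sum_deg_in_le R esym eirr k0 Gfree; rewrite cardsT /deg_in.
rewrite sum_setT => h; apply: le_trans h.
by apply/eq_ler/eq_bigr => u _; rewrite sum_setT.
Qed.

Lemma sum_sqr_deg_le : \sum_u deg u ^+ 2 <= D ^+ 2 * n.
Proof.
have := sum_sqr_deg_in_le R esym eirr k0 Gfree (ltnW k3).
rewrite cardsT /deg_in sum_setT => h; apply: le_trans h.
by apply/eq_ler/eq_bigr => u _; rewrite sum_setT.
Qed.

(** Each neighbourhood is $K_k$-free, so Turan's bound inside it gives $(1 - 1/(k-1)) d(v)^2$; the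
    squared degrees sum to at most $D^2 n$. *)
Lemma sum_triangles_le :
  \sum_v \sum_u adj v u * codeg v u <= (k%:R - 1) * (k%:R - 2) / k%:R ^+ 2 * n ^+ 3.
Proof.
have k3' := k3R.
apply: (@le_trans _ _ ((1 - (k%:R - 1)^-1) * \sum_v deg v ^+ 2)).
  rewrite mulr_sumr; apply: ler_sum => v _; rewrite -sum_nbr.
  under eq_bigr do rewrite codegE.
  apply: le_trans (sum_deg_in_le R esym eirr k1 (nbr_free v)) _.
  by rewrite -degE predk expr2 mulrA.
have h : 0 <= 1 - (k%:R - 1)^-1 :> R by rewrite -predk one_subV_ge0.
apply: le_trans (ler_wpM2l h sum_sqr_deg_le) _; apply: eq_ler; field.
by rewrite kR /=; apply: lt0r_neq0; lra.
Qed.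

(** The bound on $|B|^2$, row by row. For [u] adjacent to [v] the codegree is a degree inside the
    neighbourhood of [v], where both degree moments are bounded with [k.-1] in place of [k]; for the
    other [u] it is at most [deg v]. *)
Lemma sum_sqr_codeg_adj_le :
  \sum_v \sum_u (codeg v u + n / k%:R * adj v u) ^+ 2 <= D ^+ 2 * n ^+ 2.
Proof.
have k3' := k3R.
have kp : 0 < k%:R :> R by lra.
have n0 : 0 <= n by [].
pose a : R := (1 - 2 / k%:R) * n; pose b : R := (2 * k%:R - 2) / k%:R ^+ 2 * n ^+ 2.
have a0 : 0 <= a.
  by rewrite mulr_ge0 // subr_ge0 ler_pdivrMr // mul1r; lra.
have b0 : 0 <= b by rewrite !mulr_ge0 ?sqr_ge0 ?invr_ge0 ?exprn_ge0 //; lra.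
(* [a s^2 + b s] is tangent at [s = D] to the cubic bound coming from the neighbourhood. *)
have row v : \sum_u (codeg v u + n / k%:R * adj v u) ^+ 2 <= a * deg v ^+ 2 + b * deg v.
  rewrite (sum_nbrC v); set S := nbr e v; set s := deg v.
  have s0 : 0 <= s by rewrite /s degE.
  have sE : #|S|%:R = s by rewrite /s degE.
  have nsE : #|~: S|%:R = n - s by rewrite -sE -(cardsC S) natrD addrC addKr.
  pose be : R := 1 - (k%:R - 1)^-1.
  have be0 : 0 <= be by rewrite /be -predk one_subV_ge0.
  have h1 : \sum_(u in S) (codeg v u + n / k%:R * adj v u) ^+ 2 <=
      (be * s) ^+ 2 * s + 2 * (n / k%:R) * (be * s * s) + (n / k%:R) ^+ 2 * s.
    have -> : \sum_(u in S) (codeg v u + n / k%:R * adj v u) ^+ 2 =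
       \sum_(u in S) (n / k%:R + 1 * deg_in R e S u) ^+ 2.
      apply: eq_bigr => u; rewrite inE => evu.
      by rewrite codegE // /adj evu mulr1 mul1r addrC.
    rewrite sum_sqr_affine.
    have W := sum_sqr_deg_in_le R esym eirr k1 (nbr_free v) _.
    have {}W := W (ltac:(by case: k k3 => [|[|[]]])).
    have E := sum_deg_in_le R esym eirr k1 (nbr_free v).
    rewrite -/S predk -/be !sE in W E *.
    have c0 : 0 <= 2 * (n / k%:R) * 1 :> R by rewrite mulr1 mulr_ge0 // divr_ge0.
    have := ler_wpM2l c0 E; move: W; lra.
  have h2 : \sum_(u in ~: S) (codeg v u + n / k%:R * adj v u) ^+ 2 <= (n - s) * s ^+ 2.
    apply: (@le_trans _ _ (\sum_(u in ~: S) s ^+ 2)); last first.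
      by rewrite sumr_const -nsE mulr_natl.
    apply: ler_sum => u; rewrite !inE => evu.
    rewrite /adj (negbTE evu) mulr0 addr0 ler_pXn2r ?nnegrE ?codeg_ge0 //.
    by apply: ler_sum => w _; rewrite ler_piMr ?adj_ge0 ?adj_le1.
  apply: le_trans (lerD h1 h2) _; rewrite -subr_ge0.
  have -> : a * s ^+ 2 + b * s - ((be * s) ^+ 2 * s + 2 * (n / k%:R) * (be * s * s) +
     (n / k%:R) ^+ 2 * s + (n - s) * s ^+ 2) = s * (1 - be ^+ 2) * (s - D) ^+ 2.
    by rewrite /a /b /be; field; rewrite kR /=; apply: lt0r_neq0; lra.
  apply: mulr_ge0 (sqr_ge0 _); apply: mulr_ge0 => //; rewrite subr_ge0.
  by rewrite expr_le1 // /be lerBlDr lerDl invr_ge0; lra.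
apply: (@le_trans _ _ (\sum_v (a * deg v ^+ 2 + b * deg v))).
  by apply: ler_sum => v _; apply: row.
rewrite big_split -!mulr_sumr /=.
apply: le_trans (lerD (ler_wpM2l a0 sum_sqr_deg_le) (ler_wpM2l b0 sum_deg_le)) _.
by apply: eq_ler; rewrite /a /b; field.
Qed.

(** $\mathrm{tr} A^5$, arranged as the sum of $b A b^T$ over the rows $b$ of $A^2$. *)
Definition closed5 : R := \sum_v quad [set: V] (codeg v).

(* The polynomial inequality [x^2 (x + 1/k)^2 ((k-1)/k - x) >= 0] for the normalised
   eigenvalues [x]; it is tight at those of the Turan graph: [0], [-1/k], [(k-1)/k]. *)
Lemma closed5_le :
  closed5 <= (k%:R - 1) * ((k%:R - 1) ^+ 4 - 1) / k%:R ^+ 5 * n ^+ 5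
             - 2 * n ^+ 3 / k%:R ^+ 3 * (D * n - \sum_u deg u).
Proof.
have k3' := k3R.
pose ka : R := n / k%:R; pose b v u := codeg v u + ka * adj v u.
pose t4 := \sum_v \sum_u codeg v u ^+ 2.
pose t3 := \sum_v \sum_u adj v u * codeg v u.
pose t2 := \sum_v deg v.
have N2 : \sum_v \sum_u b v u ^+ 2 = t4 + 2 * ka * t3 + ka ^+ 2 * t2.
  rewrite !mulr_sumr -!big_split; apply: eq_bigr => v _ /=.
  rewrite /deg !mulr_sumr -!big_split; apply: eq_bigr => u _ /=.
  by rewrite -{2}(adjM R e v u) /b; ring.
(* $\mathrm{tr}(B A B)$ expanded in powers of $A$. Both mixed terms equal $\mathrm{tr} A^4$, whence
   the two forms of [t4]. *)
have B5 : \sum_v quad [set: V] (b v) = closed5 + 2 * ka * t4 + ka ^+ 2 * t3.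
  have E f : \sum_v quad [set: V] (f v) = \sum_v \sum_u \sum_w f v u * adj u w * f v w.
    apply: eq_bigr => v _; rewrite /quad sum_setT.
    by apply: eq_bigr => u _; rewrite sum_setT.
  have t4E : t4 = \sum_v \sum_u \sum_w codeg v u * adj u w * adj v w.
    apply: eq_bigr => v _; apply: eq_bigr => u _; rewrite expr2 {2}/codeg mulr_sumr.
    by apply: eq_bigr => w _; rewrite (adjC R esym w u); ring.
  have t4E' : t4 = \sum_v \sum_u \sum_w adj v u * adj u w * codeg v w.
    rewrite t4E; apply: eq_bigr => v _; rewrite exchange_big.
    by apply: eq_bigr => u _; apply: eq_bigr => w _; rewrite (adjC R esym w u); ring.
  have t3E : t3 = \sum_v \sum_u \sum_w adj v u * adj u w * adj v w.
    apply: eq_bigr => v _; apply: eq_bigr => u _; rewrite /codeg mulr_sumr.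
    by apply: eq_bigr => w _; rewrite (adjC R esym w u); ring.
  have -> : 2 * ka * t4 = ka * t4 + ka * t4 by ring.
  rewrite {1}t4E t4E' t3E /closed5 !E !mulr_sumr -!big_split; apply: eq_bigr => v _ /=.
  rewrite !mulr_sumr -!big_split; apply: eq_bigr => u _ /=.
  rewrite !mulr_sumr -!big_split; apply: eq_bigr => w _ /=.
  by rewrite /b; ring.
have Bpos : \sum_v quad [set: V] (b v) <= D * \sum_v \sum_u b v u ^+ 2.
  rewrite mulr_sumr; apply: ler_sum => v _.
  have := quad_le esym eirr k0 Gfree (b v).
  by rewrite cardsT [in X in _ <= X]sum_setT.
have N2le := sum_sqr_codeg_adj_le; have t3le := sum_triangles_le.
rewrite -/ka -/b in N2le; rewrite -/t3 in t3le.
rewrite -/t2; set N := \sum_v \sum_u b v u ^+ 2 in N2 Bpos N2le.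
have n0 : 0 <= n by [].
have kp : 0 < k%:R :> R by lra.
(* This is [D - 2 * ka], the coefficient of $|B|^2$ once $\mathrm{tr} A^4$ is eliminated; it is
   nonnegative because $k \ge 3$. *)
have c1 : 0 <= (k%:R - 3) / k%:R * n by rewrite !mulr_ge0 ?invr_ge0 //; lra.
have c2 : 0 <= 3 * ka ^+ 2 by rewrite mulr_ge0 ?sqr_ge0.
have := ler_wpM2l c1 N2le; have := ler_wpM2l c2 t3le.
have -> : closed5 = \sum_v quad [set: V] (b v) - 2 * ka * t4 - ka ^+ 2 * t3.
  by rewrite B5; ring.
have -> : 2 * ka * t4 = 2 * ka * N - 4 * ka ^+ 2 * t3 - 2 * ka ^+ 3 * t2.
  by rewrite N2; ring.
move: Bpos; set Z := \sum_v _ => Bpos h2 h1.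
apply: (@le_trans _ _ (D * N - (2 * ka * N - 4 * ka ^+ 2 * t3 - 2 * ka ^+ 3 * t2) - ka ^+ 2 * t3)).
  by rewrite !lerD2r.
have -> : D * N - (2 * ka * N - 4 * ka ^+ 2 * t3 - 2 * ka ^+ 3 * t2) - ka ^+ 2 * t3 =
   (k%:R - 3) / k%:R * n * N + 3 * ka ^+ 2 * t3 + 2 * ka ^+ 3 * t2.
  by rewrite /ka; field.
(* The term in [t2] is kept unestimated, so the edge deficiency survives with the factor
   [2 * ka ^+ 3]. *)
apply: le_trans (lerD (lerD h1 h2) (lexx _)) _; apply: eq_ler.
by rewrite /ka; field.
Qed.

(** These walks are the degenerate ones subtracted from $\mathrm{tr} A^5$, hence the lower bound.
    The estimate [codeg_ge] on edges reduces them to degree statistics, each compared with its value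
    at constant degree [D]. *)
Lemma sum_deg_walk3_ge :
  n * D ^+ 2 * (2 * D - n) - 4 * n ^+ 2 * (D * n - \sum_u deg u)
  <= \sum_v deg v * walk3 v v.
Proof.
have k3' := k3R.
pose X := D * n - \sum_u deg u.
have kp : 0 < k%:R :> R by lra.
have D0 : 0 <= D by rewrite mulr_ge0 ?one_subV_ge0.
have Dn : D <= n by rewrite ler_piMl // gerBl invr_ge0 ltW.
have Dn2 : n <= 2 * D.
  rewrite -subr_ge0 (_ : 2 * D - n = (1 - 2 / k%:R) * n); last by ring.
  by rewrite mulr_ge0 // subr_ge0 ler_pdivrMr // mul1r; lra.
have deg0 v : 0 <= deg v by rewrite degE.
have degn v : deg v <= n by rewrite degE ler_nat max_card.
have X0 : 0 <= X by rewrite subr_ge0 sum_deg_le.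
pose q := \sum_v \sum_u deg v * adj v u * deg u.
pose s2 := \sum_v deg v ^+ 2; pose s3 := \sum_v deg v ^+ 3.
have Q1 : q + s3 - n * s2 <= \sum_v deg v * walk3 v v.
  have -> : q + s3 - n * s2 = \sum_v \sum_u deg v * adj v u * (deg v + deg u - n).
    rewrite /q /s3 /s2 mulr_sumr -sumrN -!big_split; apply: eq_bigr => v _ /=.
    have -> : deg v ^+ 3 = \sum_u deg v ^+ 2 * adj v u by rewrite -mulr_sumr -/(deg v); ring.
    have -> : - (n * deg v ^+ 2) = \sum_u (- (n * deg v)) * adj v u.
      by rewrite -mulr_sumr -/(deg v); ring.
    by rewrite -!big_split; apply: eq_bigr => u _ /=; ring.
  apply: ler_sum => v _; rewrite /walk3 mulr_sumr; apply: ler_sum => u _.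
  rewrite -mulrA ler_wpM2l // mulrC (adjC R esym v u) ler_wpM2r ?adj_ge0 ?codeg_ge //.
(* The bound $A \ge -D$ is used at the vector $(D - A) 1$; then $\sum_v (d(v) - D)^2 \ge 0$ removes
   the second moment. *)
have q_ge : 3 * D ^+ 2 * (\sum_u deg u) - 2 * D ^+ 3 * n <= q.
  have := quad_ge esym eirr k0 Gfree (fun u => D + -1 * deg_in R e [set: V] u).
  rewrite sum_sqr_affine quad_affine // cardsT.
  have dE u : deg_in R e [set: V] u = deg u by rewrite /deg_in sum_setT.
  have -> : quad [set: V] (deg_in R e [set: V]) = q.
    rewrite /quad sum_setT; apply: eq_bigr => u _.
    by rewrite sum_setT; apply: eq_bigr => w _; rewrite !dE.
  rewrite !sum_setT !(eq_bigr _ (fun u _ => dE u)).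
  under [\sum_u deg_in _ _ _ _ ^+ 2]eq_bigr do rewrite dE.
  rewrite -/s2 => h.
  have h2 : 0 <= s2 - 2 * D * (\sum_u deg u) + n * D ^+ 2.
    have -> : s2 - 2 * D * (\sum_u deg u) + n * D ^+ 2 =
        \sum_(u in [set: V]) (D + -1 * deg u) ^+ 2.
      by rewrite sum_sqr_affine !sum_setT cardsT -/s2; ring.
    by apply: sumr_ge0 => u _; rewrite sqr_ge0.
  have := mulr_ge0 D0 h2; move: h; lra.
(* The cubic $x^3 - n x^2$ exceeds its tangent at [D] by $(x - D)^2 (x + 2D - n)$. *)
have s3_ge : n * (D ^+ 3 - n * D ^+ 2) - (3 * D ^+ 2 - 2 * n * D) * X <= s3 - n * s2.
  rewrite -subr_ge0.
  have -> : s3 - n * s2 - (n * (D ^+ 3 - n * D ^+ 2) - (3 * D ^+ 2 - 2 * n * D) * X) =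
    \sum_v (deg v - D) ^+ 2 * (deg v + 2 * D - n).
    have -> : n * (D ^+ 3 - n * D ^+ 2) - (3 * D ^+ 2 - 2 * n * D) * X =
      \sum_v (D ^+ 3 - n * D ^+ 2 + (3 * D ^+ 2 - 2 * n * D) * (deg v - D)).
      rewrite big_split /= sumr_const -[_ *+ #|_|]mulr_natl -mulr_sumr sumrB sumr_const.
      by rewrite -[_ *+ #|_|]mulr_natr /X; ring.
    by rewrite /s3 /s2 mulr_sumr -!sumrB; apply: eq_bigr => v _; ring.
  apply: sumr_ge0 => v _; rewrite mulr_ge0 ?sqr_ge0 //.
  by have := deg0 v; lra.
apply: le_trans Q1; rewrite -/X.
have sE : \sum_u deg u = D * n - X by rewrite /X; ring.
rewrite sE in q_ge.
have D2 : D ^+ 2 <= n ^+ 2 by rewrite ler_pXn2r ?nnegrE.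
have c : 3 * D ^+ 2 + (3 * D ^+ 2 - 2 * n * D) <= 4 * n ^+ 2.
  have : D * n <= n ^+ 2 by rewrite expr2 ler_wpM2r.
  have : D ^+ 2 <= D * n by rewrite expr2 ler_wpM2l.
  lra.
have := ler_wpM2r X0 c.
move: q_ge s3_ge; lra.
Qed.

End CliqueFree.
End Walks.

(** * Pentagons and closed walks *)

Section Pentagons.
Variables (R : realFieldType) (V : finType).

Lemma sum_delta (a : V) (F : V -> R) : \sum_c F c * (a == c)%:R = F a.
Proof.
rewrite (bigD1 a) //= eqxx mulr1 big1 ?addr0 // => c ca.
by rewrite eq_sym (negbTE ca) mulr0.
Qed.

Definition sum5 (F : V -> V -> V -> V -> V -> R) : R :=
  \sum_a \sum_b \sum_c \sum_d \sum_x F a b c d x.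

Lemma eq_sum5 (F G : V -> V -> V -> V -> V -> R) :
  (forall a b c d x, F a b c d x = G a b c d x) -> sum5 F = sum5 G.
Proof.
by move=> h; rewrite /sum5; do 5 (apply: eq_bigr => ? _); apply: h.
Qed.

(** Rotation reduces the five possible coincidences at distance two to a single one. *)
Lemma sum5_rot (F : V -> V -> V -> V -> V -> R) :
  sum5 F = sum5 (fun a b c d x => F b c d x a).
Proof.
rewrite /sum5; under eq_bigr do under eq_bigr do under eq_bigr do rewrite exchange_big.
under eq_bigr do under eq_bigr do rewrite exchange_big.
under eq_bigr do rewrite exchange_big.
by rewrite exchange_big.
Qed.

Lemma sum5D (F G : V -> V -> V -> V -> V -> R) :
  sum5 (fun a b c d x => F a b c d x + G a b c d x) = sum5 F + sum5 G.
Proof.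
by rewrite /sum5 -!big_split; do 4 (apply: eq_bigr => ? _; rewrite -!big_split).
Qed.

Lemma sum5N (F : V -> V -> V -> V -> V -> R) :
  sum5 (fun a b c d x => - F a b c d x) = - sum5 F.
Proof.
by rewrite /sum5 -!sumrN; do 4 (apply: eq_bigr => ? _; rewrite -!sumrN).
Qed.

Variable e : rel V.
Hypotheses (esym : symmetric e) (eirr : irreflexive e).
Local Notation adj := (adj R e).

Definition walk5 (a b c d x : V) : R := adj a b * adj b c * adj c d * adj d x * adj x a.

Definition cycle5 (a b c d x : V) : bool :=
  [&& e a b, e b c, e c d, e d x, e x a, a != c, a != d, b != d, b != x & c != x].

Definition inj5 : R := sum5 (fun a b c d x => (cycle5 a b c d x)%:R).

Lemma walk5_rot a b c d x : walk5 b c d x a = walk5 a b c d x.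
Proof. by rewrite /walk5; ring. Qed.

Lemma sum5_walk5 : sum5 walk5 = closed5 R e.
Proof.
rewrite /closed5 /sum5; apply: eq_bigr => a _; rewrite /quad sum_setT exchange_big /=.
apply: eq_bigr => c _; rewrite sum_setT exchange_big /=; apply: eq_bigr => d _.
rewrite /codeg -mulrA mulr_suml; apply: eq_bigr => b _.
rewrite !mulr_sumr; apply: eq_bigr => x _.
by rewrite /walk5 (adjC R esym x d) (adjC R esym x a); ring.
Qed.

(** With [a == c] the walk is a step to [b] and back, followed by a closed 3-walk from [a]. *)
Lemma sum5_walk5_ac :
  sum5 (fun a b c d x => walk5 a b c d x * (a == c)%:R) =
  \sum_v deg R e v * walk3 R e v v.
Proof.
apply: eq_bigr => a _; rewrite /deg mulr_suml; apply: eq_bigr => b _.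
under eq_bigr do under eq_bigr do rewrite -mulr_suml.
under eq_bigr do rewrite -mulr_suml.
rewrite sum_delta /walk3 mulr_sumr; apply: eq_bigr => d _.
rewrite (codegC R esym) /codeg mulr_suml mulr_sumr; apply: eq_bigr => x _.
by rewrite /walk5 (adjC R esym b a) (adjC R esym d a) -{3}(adjM R e a b); ring.
Qed.

(** The walk is then [a b a b x a]: a triangle with one edge traversed three times. *)
Lemma sum5_walk5_ac_bd :
  sum5 (fun a b c d x => walk5 a b c d x * ((a == c) && (b == d))%:R) =
  \sum_v \sum_u adj v u * codeg R e v u.
Proof.
apply: eq_bigr => a _; apply: eq_bigr => b _.
under eq_bigr => c _.
  under eq_bigr => d _ do under eq_bigr => x _ do rewrite -mulnb natrM mulrA.
  under eq_bigr => d _ do rewrite -mulr_suml.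
  rewrite sum_delta -mulr_suml; over.
rewrite sum_delta /codeg mulr_sumr; apply: eq_bigr => x _.
rewrite /walk5 (adjC R esym b a) (adjC R esym x a) (adjC R esym b x).
by rewrite -{4}(adjM R e a b) -{5}(adjM R e a b); ring.
Qed.

(* A closed 5-walk that is not a pentagon repeats a vertex at distance 2; two such
   coincidences are compatible only if disjoint, and then the walk is a triangle. *)
Lemma inj5E :
  inj5 = closed5 R e - 5 * (\sum_v deg R e v * walk3 R e v v)
         + 5 * (\sum_v \sum_u adj v u * codeg R e v u).
Proof.
pose wac a b c d x := walk5 a b c d x * (a == c)%:R.
pose wad a b c d x := walk5 a b c d x * (a == d)%:R.
pose wbd a b c d x := walk5 a b c d x * (b == d)%:R.
pose wbx a b c d x := walk5 a b c d x * (b == x)%:R.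
pose wcx a b c d x := walk5 a b c d x * (c == x)%:R.
pose v1 a b c d x := walk5 a b c d x * ((a == c) && (b == d))%:R.
pose v2 a b c d x := walk5 a b c d x * ((b == d) && (c == x))%:R.
pose v3 a b c d x := walk5 a b c d x * ((c == x) && (a == d))%:R.
pose v4 a b c d x := walk5 a b c d x * ((a == d) && (b == x))%:R.
pose v5 a b c d x := walk5 a b c d x * ((b == x) && (a == c))%:R.
rewrite -sum5_walk5 -sum5_walk5_ac -sum5_walk5_ac_bd -/wac -/v1.
have e1 : sum5 wac = sum5 wbd.
  by rewrite sum5_rot; apply: eq_sum5 => a b c d x; rewrite /wac walk5_rot.
have e2 : sum5 wbd = sum5 wcx.
  by rewrite sum5_rot; apply: eq_sum5 => a b c d x; rewrite /wbd walk5_rot.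
have e3 : sum5 wcx = sum5 wad.
  by rewrite sum5_rot; apply: eq_sum5 => a b c d x; rewrite /wcx walk5_rot eq_sym.
have e4 : sum5 wad = sum5 wbx.
  by rewrite sum5_rot; apply: eq_sum5 => a b c d x; rewrite /wad walk5_rot.
have f1 : sum5 v1 = sum5 v2.
  by rewrite sum5_rot; apply: eq_sum5 => a b c d x; rewrite /v1 walk5_rot.
have f2 : sum5 v2 = sum5 v3.
  by rewrite sum5_rot; apply: eq_sum5 => a b c d x; rewrite /v2 walk5_rot (eq_sym d a).
have f3 : sum5 v3 = sum5 v4.
  by rewrite sum5_rot; apply: eq_sum5 => a b c d x; rewrite /v3 walk5_rot (eq_sym d a).
have f4 : sum5 v4 = sum5 v5.
  by rewrite sum5_rot; apply: eq_sum5 => a b c d x; rewrite /v4 walk5_rot (eq_sym c a).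
have -> : inj5 = sum5 (fun a b c d x => walk5 a b c d x + - (wac a b c d x + wad a b c d x
    + wbd a b c d x + wbx a b c d x + wcx a b c d x) + (v1 a b c d x + v2 a b c d x
    + v3 a b c d x + v4 a b c d x + v5 a b c d x)).
  apply: eq_sum5 => a b c d x.
  have -> : (cycle5 a b c d x)%:R = walk5 a b c d x *
      [&& a != c, a != d, b != d, b != x & c != x]%:R :> R.
    by rewrite /cycle5 /walk5 /adj -!natrM !mulnb -!andbA.
  rewrite /wac /wad /wbd /wbx /wcx /v1 /v2 /v3 /v4 /v5.
  case: (eqVneq a c) => [ac|_]; case: (eqVneq a d) => [ad|_]; case: (eqVneq b d) => [bd|_];
    case: (eqVneq b x) => [bx|_]; case: (eqVneq c x) => [cx|_] /=;
    try (by rewrite ?mulr1 ?mulr0; ring); subst;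
    by rewrite /walk5 ?(adjuu R eirr) ?(mulr0, mul0r, addr0, oppr0).
rewrite !sum5D sum5N !sum5D -?e4 -?e3 -?e2 -?e1 -?f4 -?f3 -?f2 -?f1.
by ring.
Qed.

End Pentagons.

(** * Complete multipartite graphs *)

Section PartSizes.
Variable R : realFieldType.

(** Ten times the number of pentagons of a complete multipartite graph whose part sizes have power
    sums [p1] to [p5]. The three groups are the three terms of [inj5E]. *)
Definition pentagon_poly (p1 p2 p3 p4 p5 : R) : R :=
  (p1 ^+ 5 - 5 * p1 ^+ 3 * p2 + 5 * p1 ^+ 2 * p3 + 5 * p1 * p2 ^+ 2 - 5 * p1 * p4
   - 5 * p2 * p3 + 4 * p5)
  - 5 * (p1 ^+ 4 - 4 * p1 ^+ 2 * p2 + 4 * p1 * p3 + p2 ^+ 2 - 2 * p4)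
  + 5 * (p1 ^+ 3 - 3 * p1 * p2 + 2 * p3).

Definition psum (I : finType) (m : I -> R) (j : nat) : R := \sum_i m i ^+ j.

Definition parts_poly (I : finType) (m : I -> R) : R :=
  pentagon_poly (psum m 1) (psum m 2) (psum m 3) (psum m 4) (psum m 5).

Section Multipartite.
Variables (V : finType) (k : nat) (c : V -> 'I_k).
Let e : rel V := [rel u v | c u != c v].
Let s (u : V) : R := #|[set v | c v == c u]|%:R.
(** A part of size $m$ contributes $m$ vertices, so this is the power sum of degree [j + 1] of the
    part sizes. *)
Let M (j : nat) : R := \sum_u s u ^+ j.
Local Notation n := (#|V|%:R : R).

Lemma multipartite_sym : symmetric e.
Proof. by move=> u v; rewrite /e /= eq_sym. Qed.
Lemma multipartite_irr : irreflexive e.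
Proof. by move=> u; rewrite /e /= eqxx. Qed.

Let same (u v : V) : R := (c u == c v)%:R.
Let adjE u v : adj R e u v = 1 - same u v.
Proof. by rewrite /adj /e /same /=; case: eqP; rewrite ?subr0 ?subrr. Qed.

Let sum_same u (f : V -> R) (z : R) : (forall v, c u = c v -> f v = z) ->
  \sum_v same u v * f v = s u * z.
Proof.
move=> fz; rewrite /s -sum1_card natr_sum mulr_suml [RHS]big_mkcond.
apply: eq_bigr => v _; rewrite inE /same eq_sym.
by case: eqP => [cvu|_]; rewrite ?mul0r // !mul1r fz.
Qed.

Let s_eq u v : c u = c v -> s v = s u.
Proof. by rewrite /s => ->. Qed.

(** The vertex sums below are brought to this quartic shape, zero coefficients included. *)
Let sum_poly (a0 a1 a2 a3 a4 : R) :
  \sum_v (a0 + a1 * s v + a2 * s v ^+ 2 + a3 * s v ^+ 3 + a4 * s v ^+ 4) =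
  a0 * n + a1 * M 1 + a2 * M 2 + a3 * M 3 + a4 * M 4.
Proof. by rewrite !big_split /= sumr_const -!mulr_sumr mulr_natr. Qed.

Let multi_degE u : deg R e u = n - s u.
Proof.
rewrite /deg; under eq_bigr do rewrite adjE.
rewrite sumrB sumr_const; congr (_ - _).
by rewrite -[RHS]mulr1 -(@sum_same u (fun=> 1)) //; apply: eq_bigr => v _; rewrite /= mulr1.
Qed.

Let multi_codegE u v : codeg R e u v = n - s u - s v + same u v * s u.
Proof.
rewrite /codeg.
have -> : \sum_w adj R e u w * adj R e w v =
    \sum_w (1 - same u w * 1 - same v w * 1 + same u w * same w v).
  by apply: eq_bigr => w _; rewrite !adjE /same (eq_sym (c v)); ring.
rewrite big_split /= !sumrB sumr_const !(@sum_same _ (fun=> 1) 1) // !mulr1.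
congr (_ + _); rewrite (@sum_same u _ (same u v)) 1?mulrC // => w cuw.
by rewrite /same cuw.
Qed.

Let walk3E u v : walk3 R e u v =
  n ^+ 2 - n * (s u + s v) - M 1 + s u ^+ 2 + s v ^+ 2 + s u * s v - same u v * s u ^+ 2.
Proof.
rewrite /walk3.
have -> : \sum_w codeg R e u w * adj R e w v =
  \sum_w (n - s u + (- 1) * s w + 0 * s w ^+ 2 + 0 * s w ^+ 3 + 0 * s w ^+ 4) +
  \sum_w (same u w * (s u * (1 - same w v)) - same v w * (n - s u - s w)).
  rewrite -big_split; apply: eq_bigr => w _ /=.
  by rewrite multi_codegE adjE /same (eq_sym (c v)); ring.
rewrite sum_poly sumrB (@sum_same u _ (s u * (1 - same u v))); last first.
  by move=> w cuw; rewrite /same cuw.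
rewrite (@sum_same v _ (n - s u - s v)); last by move=> w /s_eq ->.
have : same u v * s v = same u v * s u.
  by rewrite /same; case: eqP => [/s_eq ->|]; rewrite ?mul0r.
by move=> h; ring.
Qed.

Lemma closed5_multipartite : closed5 R e =
  n ^+ 5 - 5 * n ^+ 3 * M 1 + 5 * n ^+ 2 * M 2 + 5 * n * M 1 ^+ 2 - 5 * n * M 3
  - 5 * M 1 * M 2 + 4 * M 4.
Proof.
(* $\mathrm{tr} A^5$ as the entrywise inner product of $A^2$ and $A^3$. *)
have -> : closed5 R e = \sum_u \sum_v codeg R e u v * walk3 R e u v.
  apply: eq_bigr => u _; rewrite /quad sum_setT.
  under eq_bigr do rewrite sum_setT.
  rewrite exchange_big; apply: eq_bigr => v _; rewrite /walk3 mulr_sumr.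
  by apply: eq_bigr => w _; rewrite /=; ring.
have -> : \sum_u \sum_v codeg R e u v * walk3 R e u v =
  \sum_u (\sum_v (
      (n ^+ 3 - 2 * n ^+ 2 * s u - n * M 1 + 2 * n * s u ^+ 2 + M 1 * s u - s u ^+ 3)
    + (- 2 * n ^+ 2 + 3 * n * s u + M 1 - 2 * s u ^+ 2) * s v
    + (2 * n - 2 * s u) * s v ^+ 2 + (-1) * s v ^+ 3 + 0 * s v ^+ 4)
    + \sum_v same u v * (n ^+ 2 * s u - 3 * n * s u ^+ 2 - M 1 * s u + 4 * s u ^+ 3)).
  apply: eq_bigr => u _; rewrite -big_split; apply: eq_bigr => v _ /=.
  rewrite multi_codegE walk3E /same; case: eqP => [/s_eq ->|_] /=; ring.
rewrite (eq_bigr (fun u => (n ^+ 4 - 3 * n ^+ 2 * M 1 + M 1 ^+ 2 + 2 * n * M 2 - M 3)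
   + (- 2 * n ^+ 3 + 4 * n * M 1 - 2 * M 2) * s u + (3 * n ^+ 2 - 3 * M 1) * s u ^+ 2
   + (- 4 * n) * s u ^+ 3 + 4 * s u ^+ 4)); last first.
  by move=> u _; rewrite sum_poly (sum_same (fun _ _ => erefl)); ring.
by rewrite sum_poly; ring.
Qed.

Lemma sum_deg_walk3_multipartite : \sum_u deg R e u * walk3 R e u u =
  n ^+ 4 - 4 * n ^+ 2 * M 1 + 4 * n * M 2 + M 1 ^+ 2 - 2 * M 3.
Proof.
have -> : \sum_u deg R e u * walk3 R e u u =
  \sum_u (n ^+ 3 - n * M 1 + (- 3 * n ^+ 2 + M 1) * s u + 4 * n * s u ^+ 2
    + (- 2) * s u ^+ 3 + 0 * s u ^+ 4).
  by apply: eq_bigr => u _; rewrite multi_degE walk3E /same eqxx /=; ring.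
by rewrite sum_poly; ring.
Qed.

Lemma sum_triangles_multipartite : \sum_u \sum_v adj R e u v * codeg R e u v =
  n ^+ 3 - 3 * n * M 1 + 2 * M 2.
Proof.
have -> : \sum_u \sum_v adj R e u v * codeg R e u v =
  \sum_u (n ^+ 2 - M 1 + (- 2 * n) * s u + 2 * s u ^+ 2 + 0 * s u ^+ 3 + 0 * s u ^+ 4).
  apply: eq_bigr => u _.
  have -> : \sum_v adj R e u v * codeg R e u v = walk3 R e u u.
    apply: eq_bigr => v _; rewrite mulrC (codegC R multipartite_sym).
    by rewrite (codegC R multipartite_sym) (adjC R multipartite_sym).
  by rewrite walk3E /same eqxx /=; ring.
by rewrite sum_poly; ring.
Qed.

Definition part_size (i : 'I_k) : R := #|[set v | c v == i]|%:R.

Lemma sum_part (f : 'I_k -> R) : \sum_u f (c u) = \sum_i part_size i * f i.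
Proof.
rewrite (partition_big c xpredT) //=; apply: eq_bigr => i _.
rewrite (eq_bigr (fun=> f i)) => [|u /eqP -> //].
rewrite sumr_const /part_size mulr_natl; congr (_ *+ _).
by apply: eq_card => u; rewrite !inE.
Qed.

Lemma psum_part_size j : psum part_size j.+1 = \sum_u s u ^+ j.
Proof. by rewrite (sum_part (fun i => part_size i ^+ j)); apply: eq_bigr => i _; rewrite exprS. Qed.

Lemma inj5_multipartite : inj5 R e = parts_poly part_size.
Proof.
rewrite (inj5E R multipartite_sym multipartite_irr) closed5_multipartite.
rewrite sum_deg_walk3_multipartite sum_triangles_multipartite.
rewrite /parts_poly /pentagon_poly !psum_part_size.
rewrite [\sum_u s u ^+ 0](_ : _ = n) //.
by rewrite sumr_const.
Qed.

End Multipartite.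

(** * Moving a vertex between two parts *)

Section Balancing.
Variables (I : finType) (m m' : I -> nat) (i j : I).
Hypotheses (ij : i != j) (mi : m i = (m' i).+1) (mj : m' j = (m j).+1).
Hypothesis mE : forall l, l != i -> l != j -> m' l = m l.
Hypotheses (lt_ji : (m j < m' i)%N) (mj0 : (0 < m j)%N).
Hypothesis third : exists2 l, (l != i) && (l != j) & (0 < m l)%N.

(** The sizes $a + 1, b$ become $a, b + 1$ with $a > b$. The gain is $5 (a - b)$ times a sum of
    nonnegative terms, among them $4 a b r$ with $r$ the total of the other parts; it is positive
    since $b \ge 1$ and, by [third], $r \ge 1$. *)
Lemma parts_poly_balance :
  parts_poly (fun l => (m l)%:R) < parts_poly (fun l => (m' l)%:R).
Proof.
pose a : R := (m' i)%:R; pose b : R := (m j)%:R.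
pose P l := (l != i) && (l != j).
pose rho t := \sum_(l | P l) ((m l)%:R : R) ^+ t.
have ji : j != i by rewrite eq_sym.
have split (f : I -> R) : \sum_l f l = f i + f j + \sum_(l | P l) f l.
  by rewrite (bigD1 i) //= (bigD1 j) //= addrA.
have pm t : psum (fun l => (m l)%:R : R) t = (a + 1) ^+ t + b ^+ t + rho t.
  by rewrite /psum split mi -natr1.
have pm' t : psum (fun l => (m' l)%:R : R) t = a ^+ t + (b + 1) ^+ t + rho t.
  rewrite /psum split mj -natr1; congr (_ + _).
  by apply: eq_bigr => l /andP[li lj]; rewrite mE.
rewrite -subr_gt0 /parts_poly !pm !pm'.
set r := rho 1%N.
have -> : pentagon_poly (a ^+ 1 + (b + 1) ^+ 1 + r) (a ^+ 2 + (b + 1) ^+ 2 + rho 2)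
      (a ^+ 3 + (b + 1) ^+ 3 + rho 3) (a ^+ 4 + (b + 1) ^+ 4 + rho 4)
      (a ^+ 5 + (b + 1) ^+ 5 + rho 5) -
    pentagon_poly ((a + 1) ^+ 1 + b ^+ 1 + r) ((a + 1) ^+ 2 + b ^+ 2 + rho 2)
      ((a + 1) ^+ 3 + b ^+ 3 + rho 3) ((a + 1) ^+ 4 + b ^+ 4 + rho 4)
      ((a + 1) ^+ 5 + b ^+ 5 + rho 5) =
  5 * (a - b) * ((a + b - 1) * (r ^+ 2 - rho 2) + 4 * (a * b * r)
    + 2 * (a + b - 1) * (r * (r - 1))
    + 2 * (r ^+ 3 - 2 * r * rho 2 + rho 3 - r ^+ 2 + rho 2)).
  by rewrite /pentagon_poly; ring.
have b1 : 1 <= b by rewrite ler1n.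
have ab : b < a by rewrite ltr_nat.
have r1 : 1 <= r.
  have [l Pl ml] := third; rewrite /r /rho (bigD1 l) //= expr1.
  apply: le_trans (_ : (m l)%:R <= _); first by rewrite ler1n.
  by rewrite lerDl sumr_ge0.
have ml_le l : P l -> (m l)%:R <= r.
  by move=> Pl; rewrite /r /rho (bigD1 l) //= expr1 lerDl sumr_ge0.
have rs (x : R) : r * x = \sum_(l | P l) (m l)%:R * x.
  by rewrite /r /rho mulr_suml; apply: eq_bigr => l _; rewrite expr1.
have e2 : r ^+ 2 - rho 2 = \sum_(l | P l) (m l)%:R * (r - (m l)%:R).
  by rewrite expr2 rs /rho -sumrB; apply: eq_bigr => l _; ring.
(* In this form the sign follows from integrality: $x (x - 1) \ge 0$ for the integer $x = r -
   m_l$. *)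
have e3 : r ^+ 3 - 2 * r * rho 2 + rho 3 - r ^+ 2 + rho 2 =
    \sum_(l | P l) (m l)%:R * ((r - (m l)%:R) * (r - (m l)%:R - 1)).
  have -> : r ^+ 3 - 2 * r * rho 2 + rho 3 - r ^+ 2 + rho 2 =
    r * (r ^+ 2 - r) + ((1 - 2 * r) * rho 2 + rho 3) by ring.
  rewrite rs /rho mulr_sumr -!big_split; apply: eq_bigr => l _ /=; ring.
have rn : r = (\sum_(l | P l) m l)%:R.
  by rewrite natr_sum; apply: eq_bigr => l _; rewrite expr1.
have p2 : 0 <= r ^+ 2 - rho 2.
  by rewrite e2; apply: sumr_ge0 => l Pl; rewrite mulr_ge0 // subr_ge0 ml_le.
have p3 : 0 <= r ^+ 3 - 2 * r * rho 2 + rho 3 - r ^+ 2 + rho 2.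
  rewrite e3; apply: sumr_ge0 => l Pl; rewrite mulr_ge0 //.
  have := ml_le l Pl; rewrite rn ler_nat => h; rewrite -natrB //.
  by case: (_ - _)%N => [|x]; rewrite ?mul0r // mulr_ge0 // subr_ge0 ler1n.
have ab1 : 0 <= a + b - 1 by lra.
have p1 : 0 < a * b * r by rewrite !mulr_gt0 //; lra.
have p4 : 0 <= r * (r - 1) by rewrite mulr_ge0; lra.
rewrite mulr_gt0 //; first by lra.
have := mulr_ge0 ab1 p2; have := mulr_ge0 ab1 p4; lra.
Qed.

End Balancing.

(** $\mathrm{tr} A^5$ for $k$ parts of size $n/k$: the factor $(k-1)^5 - (k-1)$ counts the closed
    5-walks of $K_k$. *)
Definition hom_bound (k n : R) : R := (k - 1) * ((k - 1) ^+ 4 - 1) / k ^+ 5 * n ^+ 5.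

(** $\sum_v d(v) (A^3)_{vv}$ for the same graph: all degrees are $D$ and adjacent vertices have $2D
    - n$ common neighbours. *)
Definition degenerate_bound (k n : R) : R :=
  let D := (1 - k^-1) * n in n * D ^+ 2 * (2 * D - n).

(** For each of the finitely many remainders [r] the defect is a polynomial in [q] whose two leading
    degrees cancel, so it is $O(q^3)$. *)
Lemma balanced_defect (k : nat) : (0 < k)%N -> exists2 C : R, 0 <= C &
  forall q r : nat, (0 < q)%N -> (r < k)%N -> 
  let p j : R := (k - r)%:R * q%:R ^+ j + r%:R * (q.+1)%:R ^+ j in
  let n : R := (k * q + r)%:R in
  hom_bound k%:R n - 5 * degenerate_bound k%:R n - C * n ^+ 3
  <= pentagon_poly (p 1) (p 2) (p 3) (p 4) (p 5).
Proof.
move=> k0; have kR : k%:R != 0 :> R by rewrite pnatr_eq0 -lt0n.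
pose p (r q : R) j : R := (k%:R - r) * q ^+ j + r * (q + 1) ^+ j.
pose G (r q : R) := let n := k%:R * q + r in
  hom_bound k%:R n - 5 * degenerate_bound k%:R n -
  pentagon_poly (p r q 1) (p r q 2) (p r q 3) (p r q 4) (p r q 5).
(* Normalised finite differences of [G r] at the points 0, 1, 2, 3. *)
pose d0 r := G r 0; pose d1 r := G r 1 - G r 0.
pose d2 r := (G r 2 - 2 * G r 1 + G r 0) / 2.
pose d3 r := (G r 3 - 3 * G r 2 + 3 * G r 1 - G r 0) / 6.
(* The terms of degree 4 and 5 in [q] cancel; the remaining cubic is in Newton form. *)
have GE r q : G r q = d0 r + d1 r * q + d2 r * (q * (q - 1)) + d3 r * (q * (q - 1) * (q - 2)).
  rewrite /d0 /d1 /d2 /d3 /G /p /hom_bound /degenerate_bound /pentagon_poly.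
  by field.
pose C := \sum_(r < k) (`|d0 r%:R| + `|d1 r%:R| + `|d2 r%:R| + 2 * `|d3 r%:R|).
have pos (r : R) : 0 <= `|d0 r| + `|d1 r| + `|d2 r| + 2 * `|d3 r|.
  by rewrite !addr_ge0 // mulr_ge0.
exists C; first by apply: sumr_ge0.
move=> q r q0 rk /=.
have -> : (k * q + r)%:R = k%:R * q%:R + r%:R :> R by rewrite natrD natrM.
have pE j : (k - r)%:R * q%:R ^+ j + r%:R * q.+1%:R ^+ j = p r%:R q%:R j.
  by rewrite /p natrB ?(ltnW rk) // -natr1.
rewrite !pE lerBlDr -lerBlDl -/(G r%:R q%:R) GE.
have q1 : 1 <= q%:R :> R by rewrite ler1n.
have qn : q%:R <= k%:R * q%:R + r%:R :> R.
  by rewrite -natrM -natrD ler_nat (leq_trans (leq_pmull q k0)) ?leq_addr.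
have q3 : 0 <= q%:R ^+ 3 :> R by rewrite exprn_ge0.
pose Cr := `|d0 r%:R| + `|d1 r%:R| + `|d2 r%:R| + 2 * `|d3 r%:R|.
apply: (@le_trans _ _ (Cr * q%:R ^+ 3)); last first.
  apply: (@le_trans _ _ (C * q%:R ^+ 3)).
    rewrite ler_wpM2r // /C (bigD1 (Ordinal rk)) //= lerDl.
    by apply: sumr_ge0 => l _; apply: pos.
  by rewrite ler_wpM2l ?lerXn2r ?nnegrE ?sumr_ge0 // (le_trans _ qn).
have B (d x y : R) : 0 <= x -> x <= y -> d * x <= `|d| * y.
  move=> x0 xy; apply: (@le_trans _ _ (`|d| * x)); last by rewrite ler_wpM2l.
  by rewrite ler_wpM2r // ler_norm.
set Q := q%:R : R in q1 q3 *.
have Q2 : Q <= Q ^+ 2 by rewrite ler_eXnr.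
have Q3 : Q ^+ 2 <= Q ^+ 3 by rewrite ler_weXn2l.
have h0 := B (d0 r%:R) 1 (Q ^+ 3) ler01 (exprn_ege1 _ q1).
have h1 : d1 r%:R * Q <= `|d1 r%:R| * Q ^+ 3 by apply: B; lra.
have h2 : d2 r%:R * (Q * (Q - 1)) <= `|d2 r%:R| * Q ^+ 3.
  by apply: B; [rewrite mulr_ge0; lra | lra].
have h3 : d3 r%:R * (Q * (Q - 1) * (Q - 2)) <= `|d3 r%:R| * (2 * Q ^+ 3).
  apply: B; last by lra.
  (* At [q = 1] the last factor is negative but the product vanishes. *)
  have [qE|qn1] := eqVneq q 1%N; first by rewrite /Q qE subrr mulr0 mul0r.
  have q2 : 2 <= Q by rewrite ler_nat ltn_neqAle eq_sym qn1.
  by rewrite !mulr_ge0; lra.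
by move: h0 h1 h2 h3; rewrite /Cr; lra.
Qed.

End PartSizes.

(** * Stability *)

Section Furedi.
Local Open Scope nat_scope.
Variables (V : finType) (e : rel V).
Hypotheses (esym : symmetric e) (eirr : irreflexive e).

Lemma sum_nbr_card (S : {set V}) u : \sum_(v in S) e u v = #|S :&: nbr e u|.
Proof.
rewrite -sum1_card [RHS]big_mkcond [LHS]big_mkcond; apply: eq_bigr => v _.
by rewrite !inE; case: (v \in S) => //=; case: (e u v).
Qed.

Lemma clique_free1 (S : {set V}) : clique_free e 1 S -> S = set0.
Proof.
move=> /clique_freeP h; apply/eqP; rewrite -subset0; apply/subsetP => x xS.
have := h [set x]; rewrite cards1 sub1set ltnn [in X in _ -> X]inE; apply => //.
by apply/cliqueP => y z; rewrite !inE => /eqP -> /eqP ->; rewrite eqxx.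
Qed.

(* Furedi: peel off the non-neighbours of a vertex of maximum degree. *)
Lemma furedi_coloring k (S : {set V}) : clique_free e k.+1 S ->
  exists c : V -> nat, {in S, forall v, c v < k} /\
    \sum_(u in S) \sum_(v in S) (e u v + (e u v && (c u == c v)))
    <= \sum_(u in S) \sum_(v in S) (c u != c v).
Proof.
elim: k S => [|k IH] S Sfree.
  by exists (fun=> 0); rewrite (clique_free1 Sfree); split => [v|]; rewrite ?inE // !big_set0.
have [->|[x0 x0S]] := set_0Vmem S.
  by exists (fun=> 0); split => [v|]; rewrite ?inE // !big_set0.
pose d u := #|S :&: nbr e u|.
case: (arg_maxnP d x0S) => x xS xmax.
pose N := S :&: nbr e x; pose W := S :\: nbr e x.
have [c [cN cle]] := IH _ (clique_free_nbr esym eirr xS Sfree).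
rewrite -/N in cN cle.
have WN w : w \in W -> w \notin N by rewrite !inE => /andP[/negbTE ->]; rewrite andbF.
pose c' v := if v \in N then c v else k.
exists c'; split.
  move=> v vS; rewrite /c'; case: ifP => // vN.
  exact: (ltn_trans (cN v vN)).
have split2 (F : V -> V -> nat) : \sum_(u in S) \sum_(v in S) F u v =
   \sum_(u in N) \sum_(v in N) F u v + \sum_(u in N) \sum_(v in W) F u v
   + (\sum_(u in W) \sum_(v in N) F u v + \sum_(u in W) \sum_(v in W) F u v).
  rewrite (big_setID (nbr e x)) /= -!big_split /=; congr (_ + _);
    by apply: eq_bigr => u _; rewrite (big_setID (nbr e x)).
have cNN : \sum_(u in N) \sum_(v in N) (e u v + (e u v && (c' u == c' v))) <=
           \sum_(u in N) \sum_(v in N) (c' u != c' v).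
  apply: leq_trans (leq_trans cle _); apply: eq_leq;
    by apply: eq_bigr => u uN; apply: eq_bigr => v vN; rewrite /c' uN vN.
have cN' u v : u \in N -> v \in W -> (c' u == c' v) = false.
  move=> uN /WN/negbTE vN; rewrite /c' uN vN; apply/negbTE.
  by rewrite neq_ltn cN.
have e1 : \sum_(u in N) \sum_(v in W) (e u v + (e u v && (c' u == c' v))) =
          \sum_(u in W) \sum_(v in N) e u v.
  rewrite exchange_big; apply: eq_bigr => v vW; apply: eq_bigr => u uN.
  by rewrite cN' // andbF addn0 esym.
have e2 : \sum_(u in W) \sum_(v in N) (e u v + (e u v && (c' u == c' v))) =
          \sum_(u in W) \sum_(v in N) e u v.
  apply: eq_bigr => v vW; apply: eq_bigr => u uN.
  by rewrite eq_sym cN' // andbF addn0.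
have e3 : \sum_(u in W) \sum_(v in W) (e u v + (e u v && (c' u == c' v))) =
          \sum_(u in W) \sum_(v in W) e u v + \sum_(u in W) \sum_(v in W) e u v.
  rewrite -big_split; apply: eq_bigr => u uW; rewrite -big_split; apply: eq_bigr => v vW.
  by rewrite /c' !(negbTE (WN _ _)) // eqxx andbT.
have g1 : \sum_(u in N) \sum_(v in W) (c' u != c' v) = #|W| * #|N|.
  rewrite mulnC -sum_nat_const; apply: eq_bigr => u uN; rewrite -sum1_card.
  by apply: eq_bigr => v vW; rewrite cN'.
have g2 : \sum_(u in W) \sum_(v in N) (c' u != c' v) = #|W| * #|N|.
  rewrite -sum_nat_const; apply: eq_bigr => u uN; rewrite -sum1_card.
  by apply: eq_bigr => v vW; rewrite eq_sym cN'.
(* By maximality of [d x], every vertex of [W] has at most [#|N|] neighbours in [S]. Edges between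
   [N] and [W] occur in both orders and those inside [W] count again as monochromatic, so twice this
   inequality is what is needed. *)
have dW : \sum_(u in W) \sum_(v in N) e u v + \sum_(u in W) \sum_(v in W) e u v <= #|W| * #|N|.
  rewrite -big_split -sum_nat_const; apply: leq_sum => w wW /=.
  have wS : w \in S by move: wW; rewrite inE => /andP[].
  have : d w <= d x := xmax w wS.
  by rewrite {1}/d -sum_nbr_card (big_setID (nbr e x)).
rewrite !split2 e1 e2 e3 g1 g2.
by move: cNN dW; lia.
Qed.

End Furedi.

Section Structure.
Variables (V : finType) (e : rel V).
Hypotheses (esym : symmetric e) (eirr : irreflexive e).
Variables (k : nat) (c : V -> 'I_k).
Hypothesis Gfree : clique_free e k.+1 [set: V].

(* An edge inside a part together with one completely joined vertex from each other part
   is a clique on [k + 1] vertices. *)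
Lemma no_edge_inside_part (bad : {set V}) :
  (forall u v, u \notin bad -> c u != c v -> e u v) ->
  (forall i, (#|bad| < #|[set v | c v == i]|)%N) ->
  forall u v, e u v -> c u != c v.
Proof.
move=> good big x y exy; apply/negP => /eqP cxy.
have ex i : exists v, (c v == i) && (v \notin bad).
  apply/existsP; apply: contraTT (big i); rewrite negb_exists => /forallP h.
  rewrite -leqNgt; apply: subset_leq_card; apply/subsetP => v; rewrite inE => cv.
  by have := h v; rewrite cv /= negbK.
pose g i := xchoose (ex i).
have [cg gg] : (forall i, c (g i) = i) /\ (forall i, g i \notin bad).
  by split=> i; have /andP[/eqP] := xchooseP (ex i).
pose h j := if j == c x then x else g j.
have ch j : c (h j) = j by rewrite /h; case: eqP => [->|].
have yh j : y != h j.
  apply/eqP => yE; have jE : j = c x by rewrite cxy yE ch.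
  by move: exy; rewrite yE /h jE eqxx eirr.
have yi : y \notin [set h j | j : 'I_k] by apply/imsetP => -[j _ /eqP]; rewrite (negbTE (yh j)).
have eh i j : i != j -> e (h i) (h j).
  move=> ij; have [ix|ix] := eqVneq i (c x).
    rewrite esym; apply: good; last by rewrite !ch eq_sym.
    by rewrite /h -ix eq_sym (negbTE ij).
  by apply: good; rewrite ?ch // /h (negbTE ix).
have ey j : e (h j) y.
  have [jx|jx] := eqVneq j (c x); first by rewrite /h jx eqxx.
  by apply: good; [rewrite /h (negbTE jx) | rewrite ch -cxy].
have /clique_freeP/(_ (y |: [set h j | j : 'I_k]) (subsetT _)) := Gfree.
rewrite cardsU1 yi card_imset; last by move=> i j /(congr1 c); rewrite !ch.
rewrite card_ord add1n ltnn => /(_ _)/negP; case=> //.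
apply/cliqueP => u v /setU1P[->|/imsetP[i _ ->]] /setU1P[->|/imsetP[j _ ->]].
- by rewrite eqxx.
- by rewrite esym.
- by [].
- by move=> hij; apply: eh; apply: contraNneq hij => ->.
Qed.

End Structure.

Section Stability.
Variables (R : realFieldType) (V : finType) (e : rel V).
Hypotheses (esym : symmetric e) (eirr : irreflexive e).
Variable k : nat.
Hypotheses (k0 : (0 < k)%N) (Gfree : clique_free e k.+1 [set: V]).
Local Notation n := (#|V|%:R : R).

(** Furedi's colouring gives [E + mono <= cross], and [cross] is $(1 - 1/k) n^2$ minus the squared
    deviations of the part sizes. So [mono] and the deviations total at most [C], at most [2 * C]
    ordered cross pairs are missing, and every part outnumbers the vertices on missing pairs; then
    [no_edge_inside_part] applies. *)
Lemma near_turan_partite (C : R) : 0 <= C -> k%:R * (3 * C + 3) < n ->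
  (1 - k%:R^-1) * n ^+ 2 - C <= \sum_u deg R e u ->
  exists c : V -> 'I_k, (forall u v, e u v -> c u != c v) /\
    (forall i, 2 <= part_size R c i).
Proof.
move=> C0 nbig degs.
have kR : 0 < k%:R :> R by rewrite ltr0n.
have [c0 [c0k c0le]] := furedi_coloring esym eirr Gfree.
pose c v : 'I_k := Ordinal (c0k v (in_setT v)).
have cE u v : (c0 u == c0 v) = (c u == c v) by [].
pose mono := \sum_u \sum_v ((e u v && (c u == c v))%:R : R).
pose miss := \sum_u \sum_v ((~~ e u v && (c u != c v))%:R : R).
pose cross := \sum_u \sum_v ((c u != c v)%:R : R).
pose E := \sum_u deg R e u.
have le1 : E + mono <= cross.
  have setTE (f : V -> nat) : (\sum_(u in [set: V]) f u = \sum_u f u)%N.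
    by apply: eq_bigl => u; rewrite inE.
  have -> : E + mono = (\sum_u \sum_v (e u v + (e u v && (c0 u == c0 v))))%N%:R.
    rewrite natr_sum -big_split; apply: eq_bigr => u _.
    by rewrite natr_sum /deg -big_split; apply: eq_bigr => v _; rewrite natrD.
  have -> : cross = (\sum_u \sum_v (c0 u != c0 v))%N%:R.
    by rewrite natr_sum; apply: eq_bigr => u _; rewrite natr_sum.
  rewrite ler_nat; move: c0le; rewrite !setTE.
  under eq_bigr do rewrite setTE.
  by under [X in (_ <= X)%N -> _]eq_bigr do rewrite setTE.
pose p i := part_size R c i.
have crossE : cross = n ^+ 2 - \sum_i p i ^+ 2.
  have -> : cross = \sum_u (n - p (c u)).
    apply: eq_bigr => u _.
    have -> : \sum_v ((c u != c v)%:R : R) = \sum_v (1 - (c v == c u)%:R).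
      by apply: eq_bigr => v _; rewrite eq_sym; case: eqP; rewrite ?subrr ?subr0.
    rewrite sumrB sumr_const; congr (_ - _).
    rewrite /p /part_size -sum1_card natr_sum [RHS]big_mkcond.
    by apply: eq_bigr => v _; rewrite inE; case: eqP.
  rewrite sumrB sumr_const (sum_part c p) -[_ *+ _]mulr_natl expr2; congr (_ - _).
have sump : \sum_i p i = n.
  have := sum_part c (fun=> 1 : R); rewrite sumr_const => ->.
  by apply: eq_bigr => i _; rewrite mulr1.
have dev : \sum_i (p i - n / k%:R) ^+ 2 = \sum_i p i ^+ 2 - n ^+ 2 / k%:R.
  have -> : \sum_i (p i - n / k%:R) ^+ 2 =
     \sum_i (p i ^+ 2 + (- 2 * (n / k%:R)) * p i + (n / k%:R) ^+ 2).
    by apply: eq_bigr => i _; ring.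
  rewrite !big_split /= -mulr_sumr sump sumr_const card_ord -[_ *+ k]mulr_natl.
  by field; rewrite lt0r_neq0.
have dev0 : 0 <= \sum_i (p i - n / k%:R) ^+ 2 by apply: sumr_ge0 => i _; rewrite sqr_ge0.
have mono0 : 0 <= mono by apply: sumr_ge0 => u _; apply: sumr_ge0.
have missE : miss = cross - E + mono.
  rewrite /miss /cross /E /mono -sumrB -big_split; apply: eq_bigr => u _ /=.
  rewrite /deg -sumrB -big_split; apply: eq_bigr => v _ /=.
  by rewrite /adj; case: (e u v); case: (c u == c v) => /=; ring.
rewrite -/E in degs.
have miss2 : miss <= 2 * C by rewrite missE; lra.
have pbig i : 2 * C + 2 < p i.
  have : (p i - n / k%:R) ^+ 2 <= C.
    have : (p i - n / k%:R) ^+ 2 <= \sum_i (p i - n / k%:R) ^+ 2.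
      by rewrite (bigD1 i) //= lerDl; apply: sumr_ge0 => j _; rewrite sqr_ge0.
    lra.
  (* If [p i <= 2 * C + 2], its deviation from [n / k%:R] would exceed [C + 1], whereas the square
     of the deviation is at most [C]. *)
  have : 3 * C + 3 < n / k%:R by rewrite ltr_pdivlMr // mulrC.
  move=> nk; case: ltP => // pi dC; exfalso.
  suff : (C + 1) ^+ 2 <= (p i - n / k%:R) ^+ 2 by nra.
  by rewrite -[leRHS]sqrrN lerXn2r ?nnegrE; lra.
(* The vertices on a missing cross pair; each accounts for at least one unit of [miss]. *)
pose bad : {set V} := [set u | [exists v, ~~ e u v && (c u != c v)]].
have badle : #|bad|%:R <= miss.
  rewrite -sum1_card natr_sum big_mkcond /=; apply: ler_sum => u _.
  rewrite inE; case: existsP => [[v uv]|_]; last by apply: sumr_ge0.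
  by rewrite (bigD1 v) //= uv lerDl; apply: sumr_ge0.
exists c; split.
  apply: (no_edge_inside_part esym eirr Gfree (bad := bad)) => [u v|i].
    by rewrite inE negb_exists => /forallP/(_ v); rewrite negb_and negbK => /orP[//|/negP].
  rewrite -(ltr_nat R); apply: le_lt_trans badle _.
  by have := pbig i; rewrite /p /part_size; lra.
by move=> i; have := pbig i; rewrite /p; lra.
Qed.
End Stability.

(** * Counting copies by embeddings *)

Local Open Scope nat_scope.

Section Embeddings.

Definition edge_image (U V : finType) (H : sgraph U) (f : U -> V) : {set {set V}} :=
  [set [set f x | x in e] | e : {set U} in edges H].

Definition embeddings (U V : finType) (H : sgraph U) (G : sgraph V) : {set {ffun U -> V}} :=
  [set f : {ffun U -> V} | injectiveb f && (edge_image H f \subset edges G)].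

Lemma embeddingsP (U V : finType) (H : sgraph U) (G : sgraph V) (f : {ffun U -> V}) :
  reflect (injective f /\ edge_image H f \subset edges G) (f \in embeddings H G).
Proof. by rewrite inE; apply: (iffP andP) => -[/injectiveP]. Qed.

Definition copy_of (U V : finType) (H : sgraph U) (f : U -> V) : {set V} * {set {set V}} :=
  ([set f x | x : U], edge_image H f).

Lemma copiesE (U V : finType) (H : sgraph U) (G : sgraph V) :
  copies H G = [set copy_of H f | f : {ffun U -> V} in embeddings H G].
Proof.
apply/setP => -[S1 S2]; rewrite inE; apply/andP/imsetP.
  move=> [/andP[/= S2G _] /existsP[f /and3P[finj /eqP /= fS1 /eqP /= fS2]]].
  exists f; last by rewrite /copy_of -fS1 -fS2.
  by rewrite inE finj /edge_image fS2.
move=> [f /embeddingsP[finj fG] [-> ->]]; split.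
  rewrite /is_subgraph /= fG; apply/forall_inP => _ /imsetP[d _ ->].
  by apply/subsetP => _ /imsetP[x _ ->]; apply: imset_f.
by apply/existsP; exists f; rewrite !eqxx andbT andbT; apply/injectiveP.
Qed.

Lemma edge_image_comp (U V W : finType) (H : sgraph U) (g : V -> W) (f : U -> V) :
  edge_image H (g \o f) = [set [set g x | x in e] | e : {set V} in edge_image H f].
Proof.
rewrite /edge_image -imset_comp; apply: eq_imset => d /=.
by rewrite imset_comp.
Qed.

Lemma edge_image_self (U : finType) (H : sgraph U) (s : {ffun U -> U}) :
  s \in embeddings H H -> edge_image H s = edges H.
Proof.
move=> /embeddingsP[sinj sH]; apply/eqP; rewrite eqEcard sH /=.
by rewrite card_imset //; apply: imset_inj.
Qed.

(** Embeddings with the same image copy differ by precomposition with a self-embedding of [H], so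
    all fibres of [copy_of] have the same size. *)
Lemma card_embeddings (U V : finType) (H : sgraph U) (G : sgraph V) :
  #|embeddings H G| = #|embeddings H H| * nu H G.
Proof.
rewrite -sum1_card (partition_big_imset (fun f : {ffun U -> V} => copy_of H f)) /=.
rewrite -copiesE /nu mulnC -sum_nat_const.
apply: eq_bigr => S; rewrite copiesE => /imsetP[f0 f0G ->].
have /embeddingsP[f0inj f0e] := f0G.
pose comp0 (s : {ffun U -> U}) : {ffun U -> V} := [ffun x => f0 (s x)].
have comp0_inj : injective comp0.
  by move=> s t /ffunP st; apply/ffunP => x; have := st x; rewrite !ffunE => /f0inj.
rewrite -(card_imset _ comp0_inj) sum1_card; apply: eq_card => f.
have compE (s : {ffun U -> U}) : s \in embeddings H H ->
    edge_image H (comp0 s) = edge_image H f0.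
  move=> sH; rewrite -[RHS]/[set [set f0 x | x in e] | e : {set U} in edges H].
  rewrite -(edge_image_self sH) -edge_image_comp; apply: eq_imset => d.
  by apply: eq_imset => x; rewrite ffunE.
rewrite unfold_in; apply/andP/imsetP => [[fG /eqP[fV fE]]|[s sH ->]].
  have /embeddingsP[finj fe] := fG.
  have ex x : exists y, f0 y == f x.
    have : f x \in [set f x | x : U] by apply: imset_f.
    by rewrite fV => /imsetP[y _ ->]; exists y.
  pose s := [ffun x => xchoose (ex x)].
  have sE x : f0 (s x) = f x by rewrite ffunE; apply/eqP/(xchooseP (ex x)).
  exists s; last by apply/ffunP => x; rewrite ffunE sE.
  apply/embeddingsP; split.
    by move=> x y sxy; apply: finj; rewrite -!sE sxy.
  apply/subsetP => _ /imsetP[d dH ->].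
  have : [set f x | x in d] \in edge_image H f0 by rewrite -fE; apply: imset_f.
  move=> /imsetP[d' d'H]; suff -> : [set f x | x in d] = [set f0 x | x in [set s x | x in d]].
    by move/(imset_inj f0inj) ->.
  by rewrite -imset_comp; apply: eq_imset => x /=; rewrite sE.
have /embeddingsP[sinj _] := sH; split.
  apply/embeddingsP; rewrite compE //; split => //.
  by move=> x y; rewrite !ffunE => /f0inj /sinj.
rewrite /copy_of compE //; apply/eqP; congr (_, _).
have -> : [set comp0 s x | x : U] = [set f0 x | x in [set s x | x : U]].
  by rewrite -imset_comp; apply: eq_imset => x; rewrite ffunE.
have -> : [set s x | x : U] = [set: U].
  by apply/eqP; rewrite eqEcard subsetT /= card_imset // cardsT.
by apply/setP => y; apply/imsetP/imsetP => -[x _ ->]; exists x.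
Qed.

End Embeddings.

Definition gadj (V : finType) (G : sgraph V) : rel V := [rel u v | [set u; v] \in edges G].

Lemma card_edge (V : finType) (G : sgraph V) (d : {set V}) : d \in edges G -> #|d| = 2.
Proof. by case: G => E /= /forall_inP EG /EG /eqP. Qed.

Lemma gadj_sym (V : finType) (G : sgraph V) : symmetric (gadj G).
Proof. by move=> u v; rewrite /gadj /= setUC. Qed.

Lemma gadj_irr (V : finType) (G : sgraph V) : irreflexive (gadj G).
Proof.
by move=> u; rewrite /gadj /= setUid; apply/negP => /card_edge; rewrite cards1.
Qed.

Section Cliques.

Lemma Ffree_embeddings (U V : finType) (H : sgraph U) (G : sgraph V) :
  Ffree H G = (embeddings H G == set0).
Proof. by rewrite /Ffree copiesE imset_eq0. Qed.

Lemma Ffree_complete (V : finType) (G : sgraph V) (m : nat) :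
  Ffree (complete m) G = clique_free (gadj G) m [set: V].
Proof.
rewrite Ffree_embeddings; apply/eqP/clique_freeP => [E0 C _ /cliqueP Ccl|h].
  rewrite ltnNge; apply/negP => mC.
  pose f : {ffun 'I_m -> V} := [ffun i => enum_val (widen_ord mC i)].
  suff : f \in embeddings (complete m) G by rewrite E0 inE.
  have finj : injective f.
    by move=> i j; rewrite !ffunE => /enum_val_inj /(congr1 val) /= /val_inj.
  apply/embeddingsP; split => //.
  apply/subsetP => _ /imsetP[d + ->]; rewrite inE => /cards2P[i [j [ij ->]]].
  rewrite imsetU !imset_set1; apply: Ccl; rewrite ?ffunE ?enum_valP //.
  by rewrite -!(ffunE (fun i => enum_val (widen_ord mC i))) (inj_eq finj).
apply/eqP; rewrite -subset0; apply/subsetP => f /embeddingsP[finj /subsetP fe].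
have := h [set f i | i : 'I_m] (subsetT _).
rewrite card_imset // card_ord ltnn [in X in _ -> X]inE; apply.
apply/cliqueP => _ _ /imsetP[i _ ->] /imsetP[j _ ->] fij.
apply: fe; apply/imsetP; exists [set i; j]; last by rewrite imsetU !imset_set1.
by rewrite inE cards2; case: (eqVneq i j) fij => [->|]; rewrite ?eqxx.
Qed.

End Cliques.

Section CountPentagons.

Local Notation o0 := (@Ordinal 5 0 isT).
Local Notation o1 := (@Ordinal 5 1 isT).
Local Notation o2 := (@Ordinal 5 2 isT).
Local Notation o3 := (@Ordinal 5 3 isT).
Local Notation o4 := (@Ordinal 5 4 isT).

Lemma card_ffun5 (V : finType) (P : V -> V -> V -> V -> V -> bool) :
  #|[set f : {ffun 'I_5 -> V} | P (f o0) (f o1) (f o2) (f o3) (f o4)]| =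
  \sum_a \sum_b \sum_c \sum_d \sum_x P a b c d x.
Proof.
rewrite !pair_bigA /=.
pose h (p : V * V * V * V * V) : {ffun 'I_5 -> V} :=
  [ffun i : 'I_5 => nth p.2 [:: p.1.1.1.1; p.1.1.1.2; p.1.1.2; p.1.2; p.2] i].
have hbij : bijective h.
  exists (fun f : {ffun 'I_5 -> V} => (f o0, f o1, f o2, f o3, f o4)).
    by move=> [[[[a b] c] d] x]; rewrite !ffunE.
  move=> f; apply/ffunP => -[[|[|[|[|[|i]]]]] hi]; rewrite ffunE //=; congr (f _);
    exact: val_inj.
rewrite -sum1_card (reindex h) /=; last exact: onW_bij.
rewrite big_mkcond; apply: eq_bigr => p _; rewrite inE !ffunE /=.
by case: P.
Qed.

Lemma embeddings_C5E (V : finType) (G : sgraph V) (f : {ffun 'I_5 -> V}) :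
  (f \in embeddings C5 G) = cycle5 (gadj G) (f o0) (f o1) (f o2) (f o3) (f o4).
Proof.
have ordSE : [/\ ordS o0 = o1, ordS o1 = o2, ordS o2 = o3, ordS o3 = o4 & ordS o4 = o0].
  by split; apply: val_inj.
apply/embeddingsP/idP => [[finj /subsetP fe]|].
  have fedge i : gadj G (f i) (f (ordS i)).
    apply: fe; apply/imsetP; exists [set i; ordS i]; last by rewrite imsetU !imset_set1.
    by apply/imsetP; exists i.
  have [s0 s1 s2 s3 s4] := ordSE.
  have := fedge o0; have := fedge o1; have := fedge o2; have := fedge o3; have := fedge o4.
  rewrite s0 s1 s2 s3 s4 => h4 h3 h2 h1 h0.
  by rewrite /cycle5 h0 h1 h2 h3 h4 !(inj_eq finj).
have gneq u v : gadj G u v -> u != v.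
  by move=> uv; apply/eqP => uE; rewrite uE gadj_irr in uv.
move=> /and5P[h0 h1 h2 h3 /and5P[h4 n02 n03 n13 /andP[n14 n24]]].
split; last first.
  apply/subsetP => _ /imsetP[_ /imsetP[i _ ->] ->]; rewrite imsetU !imset_set1.
  have [s0 s1 s2 s3 s4] := ordSE.
  have : i \in [:: o0; o1; o2; o3; o4].
    by case: i => [[|[|[|[|[|i]]]]] hi].
  rewrite !inE => /orP[|/orP[|/orP[|/orP[|]]]] /eqP ->; rewrite ?s0 ?s1 ?s2 ?s3 ?s4 //.
have [m0 m1 m2 m3 m4] := And5 (gneq _ _ h0) (gneq _ _ h1) (gneq _ _ h2) (gneq _ _ h3) (gneq _ _ h4).
have : uniq [:: f o0; f o1; f o2; f o3; f o4].
  by rewrite /= !inE !negb_or m0 n02 n03 m1 n13 n14 m2 n24 m3 (eq_sym _ (f o4)) m4.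
move=> funiq i j fij.
have E (l : 'I_5) : f l = nth (f o0) [:: f o0; f o1; f o2; f o3; f o4] l.
  by case: l => [[|[|[|[|[|l]]]]] hl] //=; congr (f _); apply: val_inj.
have := @nth_uniq _ (f o0) [:: f o0; f o1; f o2; f o3; f o4] i j (ltn_ord i) (ltn_ord j) funiq.
by rewrite -!E fij eqxx => /esym/eqP/val_inj.
Qed.

Lemma card_embeddings_C5 (V : finType) (G : sgraph V) :
  #|embeddings C5 G| = \sum_a \sum_b \sum_c \sum_d \sum_x cycle5 (gadj G) a b c d x.
Proof.
rewrite -card_ffun5; apply: eq_card => f; rewrite [in RHS]inE.
exact: embeddings_C5E.
Qed.

Definition c5_near (i j : nat) : bool := (j == i.+1 %% 5) || (i == j.+1 %% 5).

Lemma gadj_C5 (i j : 'I_5) : gadj C5 i j = c5_near i j.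
Proof.
rewrite /gadj /c5_near /=; apply/imsetP/orP => [[l _ /setP E]|].
  have := E i; have := E j; have := E l; have := E (ordS l).
  rewrite !inE !eqxx ?orbT /= -!val_eqE /=.
  by case: i j l {E} => [[|[|[|[|[|i]]]]] hi] // [[|[|[|[|[|j]]]]] hj] //
    [[|[|[|[|[|l]]]]] hl] //=; auto.
by case=> /eqP E; [exists i | exists j] => //; [|rewrite setUC]; congr [set _; _]; apply: val_inj.
Qed.

Lemma card_automorphisms_C5 : #|embeddings C5 C5| = 10.
Proof.
rewrite card_embeddings_C5.
(* Phrased on [nat], so that the sum over all quintuples can be evaluated by computation. *)
pose F (a b c d x : nat) : nat :=
  [&& c5_near a b, c5_near b c, c5_near c d, c5_near d x, c5_near x a,
  a != c, a != d, b != d, b != x & c != x].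
have -> : \sum_(a : 'I_5) \sum_(b : 'I_5) \sum_(c : 'I_5) \sum_(d : 'I_5) \sum_(x : 'I_5)
    cycle5 (gadj C5) a b c d x =
  \sum_(0 <= a < 5) \sum_(0 <= b < 5) \sum_(0 <= c < 5) \sum_(0 <= d < 5)
    \sum_(0 <= x < 5) F a b c d x.
  by do 5 (rewrite big_mkord; apply: eq_bigr => ? _); rewrite /cycle5 !gadj_C5.
by rewrite unlock; vm_compute.
Qed.

Lemma inj5_nu (R : realFieldType) (V : finType) (G : sgraph V) :
  inj5 R (gadj G) = ((10 * nu C5 G)%N%:R)%R.
Proof.
rewrite -card_automorphisms_C5 -card_embeddings card_embeddings_C5 /inj5 /sum5.
by do 4 (rewrite natr_sum; apply: eq_bigr => ? _); rewrite natr_sum.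
Qed.

End CountPentagons.

(** * Extremal graphs *)

Lemma gadj_inj (V : finType) (G G' : sgraph V) : gadj G =2 gadj G' -> G = G'.
Proof.
move=> GG; apply: val_inj; apply/setP => d /=.
have [/eqP/cards2P[u [v [_ ->]]]|d2] := eqVneq #|d| 2; first exact: GG.
by apply/idP/idP => /card_edge/eqP; rewrite (negbTE d2).
Qed.

Lemma gadj_multipartite (V : finType) (P : eqType) (c : V -> P) u v :
  gadj (complete_multipartite c) u v = (c u != c v).
Proof.
apply/imset2P/idP => [[x y _ + /setP E]|cuv]; last first.
  by exists u v; rewrite ?inE.
rewrite inE /= => cxy; have := E u; have := E v; rewrite !inE !eqxx orbT /=.
have := E y; have := E x; rewrite !inE !eqxx orbT /= => ex ey.
move=> /esym/orP[]/eqP vE /esym/orP[]/eqP uE; move: ex ey cxy; rewrite uE vE //.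
- by rewrite !orbb => _ /eqP ->; rewrite eqxx.
- by move=> _ _; rewrite eq_sym.
- by rewrite !orbb => /eqP ->; rewrite eqxx.
Qed.

Lemma multipartite_free (V : finType) (k : nat) (c : V -> 'I_k) :
  Ffree (complete k.+1) (complete_multipartite c).
Proof.
rewrite Ffree_complete; apply/clique_freeP => C _ /cliqueP Ccl.
rewrite ltnS -[X in _ <= X]card_ord -(@card_in_imset _ _ c C); first exact: max_card.
move=> x y xC yC cxy; apply/eqP; apply: contraPT cxy => xy.
by have := Ccl x y xC yC xy; rewrite gadj_multipartite => /eqP.
Qed.

Lemma extremal_ge (U W : finType) n (H : sgraph U) (F : sgraph W) (G : sgraph 'I_n) :
  Ffree F G -> nu H G <= extremal n H F.
Proof. by move=> GF; rewrite /extremal (bigD1 G) //= leq_maxl. Qed.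

Lemma extremal_attained (U W : finType) n (H : sgraph U) (F : sgraph W) (G0 : sgraph 'I_n) :
  Ffree F G0 -> exists2 G : sgraph 'I_n, Ffree F G & nu H G = extremal n H F.
Proof.
move=> G0F; case: (arg_maxnP (fun G => nu H G) G0F) => G GF Gmax.
exists G; first exact: GF.
apply/eqP; rewrite eqn_leq (extremal_ge _ GF) /=.
by apply/bigmax_leqP => G' G'F; apply: Gmax.
Qed.

Lemma nu_C5_lt (V : finType) (G G' : sgraph V) :
  embeddings C5 G \proper embeddings C5 G' -> nu C5 G < nu C5 G'.
Proof.
move=> /proper_card; rewrite (card_embeddings C5 G) (card_embeddings C5 G') card_automorphisms_C5.
by rewrite ltn_pmul2l.
Qed.

Definition part (V : finType) (k : nat) (c : V -> 'I_k) (i : 'I_k) : {set V} :=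
  [set v | c v == i].

Lemma sum_card_part (V : finType) (k : nat) (c : V -> 'I_k) :
  \sum_i #|part c i| = #|V|.
Proof.
rewrite -sum1_card (partition_big c xpredT) //=; apply: eq_bigr => i _.
by rewrite -sum1_card; apply: eq_bigl => v; rewrite inE.
Qed.

(** A missing cross pair [u], [v] lies on the pentagon [u v w x y] of the complete multipartite
    graph, with [w] in the part of [u], [x] in the part of [v] and [y] in a third part. *)
Lemma subgraph_multipartite_lt (V : finType) (k : nat) (c : V -> 'I_k) (G : sgraph V) :
  2 < k -> (forall i, 1 < #|part c i|) ->
  (forall u v, gadj G u v -> c u != c v) ->
  G <> complete_multipartite c -> nu C5 G < nu C5 (complete_multipartite c).
Proof.
move=> k3 big sub neq; set K := complete_multipartite c.
have [u [v [cuv uv]]] : exists u v, c u != c v /\ ~~ gadj G u v.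
  have [/existsP[u /existsP[v /andP[]]]|no] :=
    boolP [exists u, exists v, (c u != c v) && ~~ gadj G u v]; first by exists u, v.
  case: neq; apply: gadj_inj => u v; rewrite gadj_multipartite.
  apply/idP/idP => [/sub //|cuv]; apply: contraNT no => uv.
  by apply/existsP; exists u; apply/existsP; exists v; rewrite cuv uv.
have other (z : V) : exists2 w, c w = c z & w != z.
  have : 0 < #|part c (c z) :\ z|.
    by have := big (c z); rewrite (cardsD1 z) inE eqxx add1n ltnS.
  by case/card_gt0P => w; rewrite !inE => /andP[wz /eqP]; exists w.
have [w cw wu] := other u; have [x cx xv] := other v.
have [y [cyu cyv]] : exists y, c y != c u /\ c y != c v.
  have : 0 < #|~: [set c u; c v]|.
    rewrite -subn_gt0 in k3 *; have := cardsC [set c u; c v].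
    by rewrite card_ord cards2 cuv; lia.
  case/card_gt0P => i; rewrite !inE negb_or => /andP[iu iv].
  have /card_gt0P[y] : 0 < #|part c i| by apply: ltnW.
  by rewrite inE => /eqP yi; exists y; rewrite yi.
apply: nu_C5_lt; apply/properP; split.
  apply/subsetP => f; rewrite !embeddings_C5E => /and5P[h0 h1 h2 h3 /andP[h4 h5]].
  by rewrite /cycle5 !gadj_multipartite !sub.
exists [ffun i : 'I_5 => nth u [:: u; v; w; x; y] i].
  rewrite embeddings_C5E !ffunE /= /cycle5 !gadj_multipartite cw cx.
  rewrite cuv cyu (eq_sym (c v)) cuv (eq_sym _ (c y)) cyv (eq_sym u) wu (eq_sym v) xv /=.
  have ne (a b : V) : c a != c b -> a != b by apply: contraNneq => ->.
  by rewrite !ne // ?cx ?cw // eq_sym.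
by rewrite embeddings_C5E !ffunE /= /cycle5 (negbTE uv).
Qed.

(** * Balanced partitions and the Turan graph *)

Section Balanced.
Variables (n k : nat).
Hypothesis k0 : 0 < k.

Definition balanced (c : 'I_n -> 'I_k) : Prop :=
  forall i j, #|part c i| <= #|part c j|.+1.

(** A part smaller than [n %/ k] keeps all parts at most [n %/ k], making the total too small; a
    part larger than [(n %/ k).+1] makes it too large. *)
Lemma balanced_card (c : 'I_n -> 'I_k) : balanced c ->
  forall i, #|part c i| = n %/ k + (#|part c i| != n %/ k).
Proof.
move=> cb i; have nE := divn_eq n k; have rk := ltn_pmod n k0.
have sumn := sum_card_part c; rewrite card_ord in sumn.
have cst x : \sum_(j < k | j != i) x + x = k * x.
  by rewrite -[in RHS](card_ord k) -sum_nat_const [RHS](bigD1 i) //= addnC.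
have [lt|gt|<-] := ltngtP #|part c i| (n %/ k); last by rewrite addn0.
  have : \sum_j #|part c j| <= \sum_(j < k | j != i) (n %/ k) + #|part c i|.
    rewrite (bigD1 i) //= addnC leq_add2r; apply: leq_sum => j _.
    exact: leq_trans (cb j i) lt.
  by have := cst (n %/ k); rewrite sumn; lia.
case: (ltngtP #|part c i| (n %/ k).+1) => [|gt2|->]; last by rewrite addn1.
  by rewrite ltnS leqNgt gt.
have : \sum_(j < k | j != i) (n %/ k).+1 + #|part c i| <= \sum_j #|part c j|.
  rewrite [leqRHS](bigD1 i) //= [leqRHS]addnC leq_add2r; apply: leq_sum => j _.
  by rewrite -ltnS; apply: leq_trans (cb i j).
by have := cst (n %/ k).+1; rewrite sumn mulnS; lia.
Qed.

(** All balanced partitions have the same multiset of part sizes. The general [F] covers both power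
    sums and the counting of sizes. *)
Lemma sum_balanced (S : nmodType) (F : nat -> S) (c : 'I_n -> 'I_k) : balanced c ->
  (\sum_i F #|part c i| = F (n %/ k)%N *+ (k - n %% k)%N + F (n %/ k)%N.+1 *+ (n %% k)%N)%R.
Proof.
move=> cb; have pE := balanced_card cb.
pose A : {set 'I_k} := [set i | #|part c i| != n %/ k].
have cA : #|A| = n %% k.
  have : \sum_i #|part c i| = k * (n %/ k) + #|A|.
    rewrite (eq_bigr (fun i => n %/ k + (i \in A))) => [|i _]; last by rewrite inE -pE.
    by rewrite big_split sum_nat_const card_ord -sum1_card [in RHS]big_mkcond.
  by rewrite sum_card_part card_ord [in LHS](divn_eq n k) mulnC => /addnI.
rewrite (bigID (mem A)) /= addrC; congr (_ + _)%R.
  rewrite (eq_bigr (fun=> F (n %/ k))) => [|i]; last by rewrite inE negbK => /eqP ->.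
  rewrite sumr_const -cA; congr (_ *+ _)%R.
  have -> : k - #|A| = #|[predC A]| by have := cardC A; rewrite card_ord; lia.
  exact: eq_card.
rewrite (eq_bigr (fun=> F (n %/ k).+1)) => [|i]; last first.
  by rewrite inE => iA; rewrite pE iA addn1.
by rewrite sumr_const cA.
Qed.

Lemma balanced_isomorphic (c c' : 'I_n -> 'I_k) : balanced c -> balanced c' ->
  isomorphic (complete_multipartite c) (complete_multipartite c').
Proof.
move=> cb cb'.
have [p pE] : exists p : {perm 'I_k}, forall i, #|part c i| = #|part c' (p i)|.
  pose t (d : 'I_n -> 'I_k) := [tuple #|part d i| | i < k].
  have : perm_eq (t c) (t c').
    (* Lists are permutations of each other when every predicate holds equally often on both, and
       [sum_balanced] evaluates these counts. *)
    apply/seq.permP => P.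
    have cnt d : balanced d -> count P (t d) = (\sum_i (P #|part d i| : nat))%R.
      by move=> _; rewrite /= count_map -sum1_count big_mkcond big_enum.
    by rewrite !cnt // !(sum_balanced (fun x => P x : nat)).
  case/tuple_permP => p /val_inj tE; exists p => i.
  by have := congr1 (fun s => tnth s i) tE; rewrite !tnth_mktuple.
(* Each vertex goes to the vertex of equal rank in the matched part. The sizes agree, so the default
   of [nth] is never returned. *)
pose f x := nth x (enum (part c' (p (c x)))) (index x (enum (part c (c x)))).
have idx x : index x (enum (part c (c x))) < #|part c' (p (c x))|.
  by rewrite -pE cardE index_mem mem_enum inE.
have cf x : c' (f x) = p (c x).
  have : f x \in enum (part c' (p (c x))) by rewrite mem_nth // -cardE.
  by rewrite mem_enum inE => /eqP.
have finj : injective f.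
  move=> x y fxy; have cxy : c x = c y by apply: (@perm_inj _ p); rewrite -!cf fxy.
  move: fxy; rewrite /f -cxy.
  have iy : index y (enum (part c (c x))) < #|part c' (p (c x))| by rewrite cxy.
  rewrite (set_nth_default x y) -?cardE // => /eqP.
  rewrite nth_uniq ?enum_uniq -?cardE // => /eqP ixy.
  have := nth_index x (_ : x \in enum (part c (c x))).
  rewrite ixy nth_index ?mem_enum ?inE ?cxy // => -> //.
exists f; first exact: injF_bij.
have imf u v : [set f x | x in [set u; v]] = [set f u; f v] by rewrite imsetU !imset_set1.
apply/setP => d; apply/idP/imsetP.
  move=> /[dup] /card_edge/eqP/cards2P[u [v [_ ->]]] uv.
  have [g fK gK] := injF_bij finj.
  exists [set g u; g v]; last by rewrite imf !gK.
  have := gadj_multipartite c (g u) (g v); rewrite /gadj /= => ->.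
  have := gadj_multipartite c' u v; rewrite /gadj /= uv -{1}(gK u) -{1}(gK v) !cf.
  by move=> /esym; rewrite (inj_eq perm_inj).
move=> [b /[dup] /card_edge/eqP/cards2P[u [v [_ ->]]] uv ->]; rewrite imf.
have := gadj_multipartite c' (f u) (f v); rewrite /gadj /= => ->.
have := gadj_multipartite c u v; rewrite /gadj /= uv !cf (inj_eq perm_inj).
by move=> <-.
Qed.

Definition residue (i : 'I_n) : 'I_k := Ordinal (ltn_pmod i k0).

Lemma turanE : turan k n = complete_multipartite residue.
Proof. by apply: gadj_inj => u v; rewrite !gadj_multipartite. Qed.

Lemma residue_balanced : balanced residue.
Proof.
move=> i j; have := turan_balanced n (ltn_ord i) (ltn_ord j).
by congr (_ <= _.+1); apply: eq_card => u; rewrite !inE.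
Qed.

Lemma inj5_balanced (R : realFieldType) (c : 'I_n -> 'I_k) : balanced c ->
  let p j : R := ((k - n %% k)%N%:R * (n %/ k)%N%:R ^+ j
                  + (n %% k)%N%:R * (n %/ k)%N.+1%:R ^+ j)%R in
  ((10 * nu C5 (complete_multipartite c))%N%:R = pentagon_poly (p 1) (p 2) (p 3) (p 4) (p 5))%R.
Proof.
move=> cb p; rewrite -(inj5_nu R).
have -> : inj5 R (gadj (complete_multipartite c)) = inj5 R [rel u v | c u != c v].
  by apply: eq_sum5 => a b d x y; rewrite /cycle5 !gadj_multipartite.
rewrite inj5_multipartite /parts_poly.
have pE j : psum (part_size R c) j = p j.
  by rewrite /psum (sum_balanced (fun s => s%:R ^+ j)%R cb) /p !mulr_natl.
by rewrite !pE.
Qed.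

Lemma unbalanced_improve (c : 'I_n -> 'I_k) (i j : 'I_k) : 2 < k ->
  (forall l, 1 < #|part c l|) -> #|part c j|.+1 < #|part c i| ->
  exists c' : 'I_n -> 'I_k,
    nu C5 (complete_multipartite c) < nu C5 (complete_multipartite c').
Proof.
move=> k3 big lt_ji.
have ij : i != j by apply: contraTneq lt_ji => ->; rewrite -leqNgt.
have /card_gt0P[u ui] : 0 < #|part c i| by apply: ltnW.
pose c' v := if v == u then j else c v.
exists c'.
have cu : c u = i by apply/eqP; rewrite inE in ui.
have pi : part c i = u |: part c' i.
  apply/setP => v; rewrite !inE /c'; case: (eqVneq v u) => [->|//]; by rewrite cu eqxx.
have pj : part c' j = u |: part c j.
  by apply/setP => v; rewrite !inE /c'; case: (eqVneq v u) => [->|//]; rewrite eqxx.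
have ui' : u \notin part c' i by rewrite inE /c' eqxx eq_sym.
have uj : u \notin part c j by rewrite inE cu.
have mi : #|part c i| = #|part c' i|.+1 by rewrite pi cardsU1 ui' add1n.
have mj : #|part c' j| = #|part c j|.+1 by rewrite pj cardsU1 uj add1n.
have ml l : l != i -> l != j -> #|part c' l| = #|part c l|.
  move=> li lj; congr #|pred_of_set _|; apply/setP => v; rewrite !inE /c'.
  by case: (eqVneq v u) => [->|//]; rewrite cu !(eq_sym _ l) (negbTE li) (negbTE lj).
have third : exists2 l, (l != i) && (l != j) & 0 < #|part c l|.
  have : 0 < #|~: [set i; j]|.
    by have := cardsC [set i; j]; rewrite card_ord cards2 ij; lia.
  case/card_gt0P => l; rewrite !inE negb_or => lij; exists l => //.
  exact: ltnW.
have lt : #|part c j| < #|part c' i| by rewrite mi in lt_ji.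
have := @parts_poly_balance rat _ (fun l => #|part c l|) (fun l => #|part c' l|) i j
  ij mi mj ml lt (ltnW (big j)) third.
have E d : parts_poly (fun l => #|part d l|%:R : rat)%R =
    ((10 * nu C5 (complete_multipartite d))%N%:R)%R.
  rewrite -inj5_nu -inj5_multipartite.
  by apply: eq_sum5 => a b e x y; rewrite /cycle5 !gadj_multipartite.
by rewrite !E ltr_nat ltn_pmul2l.
Qed.

End Balanced.

Local Open Scope ring_scope.

(** * Lower bound at the Turan graph and upper bounds for clique-free graphs *)

Section Bounds.
Variables (R : realFieldType) (k : nat).
Hypothesis k3 : (2 < k)%N.

Let k0 : (0 < k)%N. Proof. exact: leq_trans k3. Qed.
Let kge3 : 3 <= k%:R :> R. Proof. by rewrite ler_nat. Qed.

Lemma nu_turan_ge : exists2 C : R, 0 <= C & forall n, (k <= n)%N ->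
  hom_bound k%:R n%:R - 5 * degenerate_bound k%:R n%:R - C * n%:R ^+ 3
  <= (10 * nu C5 (turan k n))%N%:R.
Proof.
have [C C0 CP] := balanced_defect R k0; exists C => // n kn.
rewrite (turanE n k0) (inj5_balanced k0 R (@residue_balanced n k k0)).
have := CP (n %/ k)%N (n %% k)%N; rewrite divn_gt0 // kn ltn_pmod // mulnC -divn_eq.
exact.
Qed.

Section Upper.
Variables (n : nat) (G : sgraph 'I_n).
Hypothesis GF : Ffree (complete k.+1) G.
Let N : R := n%:R.
Let X : R := (1 - k%:R^-1) * N * N - \sum_u deg R (gadj G) u.
Let Gfree : clique_free (gadj G) k.+1 [set: 'I_n].
Proof. by rewrite -Ffree_complete. Qed.

Lemma edge_defect_ge0 : 0 <= X.
Proof.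
have := sum_deg_le R (@gadj_sym _ G) (@gadj_irr _ G) k3 Gfree.
by rewrite card_ord subr_ge0.
Qed.

(** Degenerate walks are not subtracted here; being of lower order, they do not affect the limit. *)
Lemma nu_le_hom_bound : (10 * nu C5 G)%N%:R <= hom_bound k%:R N.
Proof.
have kp : 0 < k%:R :> R by rewrite ltr0n.
rewrite -(inj5_nu R); apply: (@le_trans _ _ (closed5 R (gadj G))).
  rewrite -(sum5_walk5 R (@gadj_sym _ G)) /inj5 /sum5.
  apply: ler_sum => a _; apply: ler_sum => b _; apply: ler_sum => c _.
  apply: ler_sum => d _; apply: ler_sum => x _.
  rewrite /walk5 /adj -!natrM ler_nat !mulnb.
  by case C: (cycle5 _ _ _ _ _ _) => //; move/and5P: C => [-> -> -> -> /andP[-> _]].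
have := closed5_le R (@gadj_sym _ G) (@gadj_irr _ G) k3 Gfree.
rewrite card_ord -/N -/X -/(hom_bound k%:R N) => h; apply: le_trans h _.
by rewrite gerBl mulr_ge0 ?edge_defect_ge0 // divr_ge0 ?exprn_ge0 // mulr_ge0 ?exprn_ge0.
Qed.

(** The deficiency [X] costs [2 * N ^+ 3 / k%:R ^+ 3] per unit in [closed5_le] and regains at most
    five times [4 * N ^+ 2] through [sum_deg_walk3_ge]; the last term bounds $5\,\mathrm{tr}
    A^3$. *)
Lemma nu_le_refined : (10 * nu C5 G)%N%:R <=
  hom_bound k%:R N - 5 * degenerate_bound k%:R N
  - (2 * N ^+ 3 / k%:R ^+ 3 - 20 * N ^+ 2) * X + 5 * N ^+ 3.
Proof.
have kp : 0 < k%:R :> R by rewrite ltr0n.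
rewrite -(inj5_nu R) (inj5E _ (@gadj_sym _ G) (@gadj_irr _ G)).
have := closed5_le R (@gadj_sym _ G) (@gadj_irr _ G) k3 Gfree.
have := sum_deg_walk3_ge R (@gadj_sym _ G) (@gadj_irr _ G) k3 Gfree.
have := sum_triangles_le R (@gadj_sym _ G) (@gadj_irr _ G) k3 Gfree.
rewrite !card_ord -/N -/X -/(hom_bound k%:R N).
have c1 : (k%:R - 1) * (k%:R - 2) / k%:R ^+ 2 * N ^+ 3 <= N ^+ 3.
  rewrite ler_piMl ?exprn_ge0 // ler_pdivrMr ?exprn_gt0 // mul1r.
  by have := kge3; nra.
rewrite /degenerate_bound; move: c1.
set T := \sum_v _; set Q := \sum_v _ * _; set E := closed5 _ _.
move=> c1 h1 h2 h3; lra.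
Qed.

End Upper.

End Bounds.

(** An extremal graph has at least as many pentagons as the Turan graph; with [nu_le_refined] this
    bounds its deficiency, so it is a spanning subgraph of a complete multipartite graph. Adding
    missing cross pairs or evening out the parts would raise the count. *)
Lemma extremal_balanced (R : archiRealFieldType) (k : nat) : (2 < k)%N ->
  exists N0 : nat, forall n, (N0 <= n)%N ->
  forall G : sgraph 'I_n, Ffree (complete k.+1) G ->
  nu C5 G = extremal n C5 (complete k.+1) ->
  exists2 c : 'I_n -> 'I_k, balanced c & G = complete_multipartite c.
Proof.
move=> k3; have k0 : (0 < k)%N by apply: leq_trans k3.
have [C C0 turan_ge] := nu_turan_ge R k3.
have kp : 0 < k%:R :> R by rewrite ltr0n.
have kp3 : 0 < k%:R ^+ 3 :> R by rewrite exprn_gt0.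
(* Once [20 * n%:R ^+ 2] is absorbed, the comparison reads $(n^3 / k^3) X \le (C + 5) n^3$, which
   gives this bound on [X]. *)
pose C' : R := (C + 5) * k%:R ^+ 3.
have C'0 : 0 <= C' by rewrite mulr_ge0 ?(ltW kp3) ?addr_ge0.
(* The first summand is the threshold of [near_turan_partite]; the second ensures $20 n^2 \le n^3 /
   k^3$. *)
pose B : R := k%:R * (3 * C' + 3) + 20 * k%:R ^+ 3.
have B1 : 0 <= k%:R * (3 * C' + 3).
  by apply: mulr_ge0 => //; apply: addr_ge0 => //; apply: mulr_ge0.
have B2 : 0 <= 20 * k%:R ^+ 3 :> R by rewrite mulr_ge0 ?(ltW kp3).
have B0 : 0 <= B by rewrite addr_ge0.
exists (maxn k (Num.bound B)) => n; rewrite geq_max => /andP[kn Bn] G GF Gext.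
have nB : B < n%:R by apply: lt_le_trans (archi_boundP B0) _; rewrite ler_nat.
have nB1 : k%:R * (3 * C' + 3) < n%:R :> R.
  by apply: le_lt_trans nB; rewrite lerDl.
have nB2 : 20 * k%:R ^+ 3 <= n%:R :> R.
  by apply/ltW/(le_lt_trans _ nB); rewrite lerDr.
have esym := @gadj_sym _ G; have eirr := @gadj_irr _ G.
have Gfree : clique_free (gadj G) k.+1 [set: 'I_n] by rewrite -Ffree_complete.
pose X : R := (1 - k%:R^-1) * n%:R * n%:R - \sum_u deg _ (gadj G) u.
have X0 : 0 <= X := edge_defect_ge0 R k3 GF.
have Xle : X <= C'.
  have n0 : 0 < n%:R :> R by rewrite ltr0n (leq_trans k0).
  have h1 := turan_ge n kn; have h2 := nu_le_refined R k3 GF; rewrite -/X in h2.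
  have h3 : (10 * nu C5 (turan k n))%N%:R <= (10 * nu C5 G)%N%:R :> R.
    rewrite ler_nat leq_mul2l Gext extremal_ge //.
    by rewrite (turanE n k0) multipartite_free.
  have h4 : n%:R ^+ 3 / k%:R ^+ 3 <= 2 * n%:R ^+ 3 / k%:R ^+ 3 - 20 * n%:R ^+ 2 :> R.
    rewrite -subr_ge0.
    have -> : 2 * n%:R ^+ 3 / k%:R ^+ 3 - 20 * n%:R ^+ 2 - n%:R ^+ 3 / k%:R ^+ 3 =
      n%:R ^+ 2 / k%:R ^+ 3 * (n%:R - 20 * k%:R ^+ 3) :> R.
      by field; rewrite lt0r_neq0.
    by rewrite mulr_ge0 ?subr_ge0 // divr_ge0 ?sqr_ge0 ?(ltW kp3).
  have h5 := ler_wpM2r X0 h4.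
  have h6 : n%:R ^+ 3 / k%:R ^+ 3 * X <= (C + 5) * n%:R ^+ 3 by lra.
  have np : 0 < n%:R ^+ 3 / k%:R ^+ 3 :> R by rewrite divr_gt0 ?exprn_gt0.
  rewrite -(ler_pM2l np); apply: le_trans h6 _; apply: eq_ler.
  by rewrite /C'; field; rewrite lt0r_neq0.
have [c [csub cbig]] : exists c : 'I_n -> 'I_k,
    (forall u v, gadj G u v -> c u != c v) /\ (forall i, 2 <= part_size R c i).
  apply: (near_turan_partite esym eirr k0 Gfree C'0); rewrite card_ord //.
  by rewrite expr2 mulrA; move: Xle; rewrite /X; lra.
have cbig' i : (1 < #|part c i|)%N by have := cbig i; rewrite /part_size ler_nat.
have GE : G = complete_multipartite c.
  have [//|/eqP neq] := eqVneq G (complete_multipartite c).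
  have := subgraph_multipartite_lt k3 cbig' csub neq.
  by rewrite Gext ltnNge extremal_ge // multipartite_free.
exists c => // i j; rewrite leqNgt; apply/negP => ij.
have [c'] := unbalanced_improve k0 k3 cbig' ij.
by rewrite -GE Gext ltnNge extremal_ge // multipartite_free.
Qed.

(** * The limit density *)

From mathcomp Require Import all_classical all_reals all_analysis.
Import Order.TTheory GRing.Theory Num.Theory.
Import numFieldNormedType.Exports.

Section Limit.
Local Open Scope classical_set_scope.
Local Open Scope ring_scope.
Variables (R : realType) (k : nat).
Hypothesis k3 : (2 < k)%N.

Lemma natrV_cvg0 : (fun n : nat => n%:R^-1 : R) @ \oo --> (0 : R).
Proof.
rewrite -cvg_shiftS; exact: cvg_harmonic.
Qed.

(** Expresses the normalisation through [n%:R^-1], so that its limit 12 follows by continuity at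
    0. *)
Lemma bin5E (n : nat) : (4 < n)%N -> let h : R := n%:R^-1 in
  n%:R ^+ 5 / (10 * 'C(n, 5)%:R) = 12 / ((1 - h) * (1 - 2 * h) * (1 - 3 * h) * (1 - 4 * h)).
Proof.
case: n => [|[|[|[|[|m]]]]] // _ h.
have : (m.+4.+1 ^_ 5)%N%:R = 120 * 'C(m.+4.+1, 5)%:R :> R by rewrite -bin_ffact mulrC natrM.
rewrite !ffactnS ffactn0 /= muln1 !natrM => E.
have m0 : 0 <= m%:R :> R by [].
have -> : 'C(m.+4.+1, 5)%:R = m.+4.+1%:R * (m.+4%:R * (m.+3%:R * (m.+2%:R * m.+1%:R))) / 120 :> R.
  by rewrite E; field.
rewrite /h; have -> : m.+4.+1%:R = m%:R + 5 :> R by rewrite -natrD; congr (_%:R); lia.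
have -> : m.+4%:R = m%:R + 4 :> R by rewrite -natrD; congr (_%:R); lia.
have -> : m.+3%:R = m%:R + 3 :> R by rewrite -natrD; congr (_%:R); lia.
have -> : m.+2%:R = m%:R + 2 :> R by rewrite -natrD; congr (_%:R); lia.
have -> : m.+1%:R = m%:R + 1 :> R by rewrite natr1.
by field; do 4?[apply/andP; split]; apply: lt0r_neq0; lra.
Qed.

Lemma main_ratio_cvg (b c : R) (l : R) :
  (fun n : nat => (l + b * n%:R^-1 + c * n%:R^-1 ^+ 2) *
     (n%:R ^+ 5 / (10 * 'C(n, 5)%:R))) @ \oo --> 12 * l.
Proof.
have h0 := natrV_cvg0.
(* The limit is written as the same expression with [n%:R^-1] replaced by 0. *)
have -> : 12 * l = (l + b * 0 + c * 0 ^+ 2) *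
   (12 * ((1 - 0) * (1 - 2 * 0) * (1 - 3 * 0) * (1 - 4 * 0))^-1) :> R by field.
have lin (a : R) : (fun n : nat => 1 - a * n%:R^-1 : R) @ \oo --> (1 - a * 0 : R).
  by apply: cvgB; [exact: cvg_cst | apply: cvgM; [exact: cvg_cst | exact: h0]].
apply: cvgM.
  apply: cvgD; first apply: cvgD; first exact: cvg_cst.
    by apply: cvgM; [exact: cvg_cst | exact: h0].
  by apply: cvgM; [exact: cvg_cst | apply: cvgM; exact: h0].
have e : \forall n \near \oo, 12 * ((1 - n%:R^-1) * (1 - 2 * n%:R^-1) * (1 - 3 * n%:R^-1)
    * (1 - 4 * n%:R^-1))^-1 = n%:R ^+ 5 / (10 * 'C(n, 5)%:R) :> R.
  by exists 5%N => // n /= n5; rewrite bin5E.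
apply: cvg_trans (near_eq_cvg e) _.
apply: cvgM; first exact: cvg_cst.
apply: cvgV.
  by rewrite !mulr0 !subr0 !mulr1 oner_eq0.
apply: cvgM; last exact: lin.
apply: cvgM; last exact: lin.
apply: cvgM; last exact: lin.
by have := lin 1; rewrite mul1r; under eq_fun do rewrite mul1r.
Qed.

Lemma max_density_cvg : max_density R k C5 @ \oo -->
  1 / k%:R ^+ 4 *
     (12 * k%:R ^+ 4 - 60 * k%:R ^+ 3 + 120 * k%:R ^+ 2 - 120 * k%:R + 48 : R).
Proof.
have k0 : (0 < k)%N by apply: leq_trans k3.
have kR : k%:R != 0 :> R by rewrite pnatr_eq0 -lt0n.
have [C C0 turan_ge] := nu_turan_ge R k3.
pose A : R := (k%:R - 1) * ((k%:R - 1) ^+ 4 - 1) / k%:R ^+ 5.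
pose d : R := 1 - k%:R^-1.
have -> : 1 / k%:R ^+ 4 *
  (12 * k%:R ^+ 4 - 60 * k%:R ^+ 3 + 120 * k%:R ^+ 2 - 120 * k%:R + 48) = 12 * A :> R.
  by rewrite /A; field.
pose r (n : nat) : R := n%:R ^+ 5 / (10 * 'C(n, 5)%:R).
apply: (@squeeze_cvgr _ _ _ _
   (fun n : nat => (A + - (5 * d ^+ 2 * (2 * d - 1)) * n%:R^-1 + - C * n%:R^-1 ^+ 2) * r n)
   (fun n : nat => (A + 0 * n%:R^-1 + 0 * n%:R^-1 ^+ 2) * r n)); last 2 first.
- exact: main_ratio_cvg.
- exact: main_ratio_cvg.
(* The Turan lower bound requires [k <= n], and the binomial coefficient is nonzero from 5 on. *)
exists (maxn k 5) => // n /=; rewrite geq_max => /andP[kn n5].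
have n0 : n%:R != 0 :> R by rewrite pnatr_eq0 -lt0n (leq_trans _ n5).
have binp : 0 < 'C(n, 5)%:R :> R by rewrite ltr0n bin_gt0.
have b0 : 'C(n, 5)%:R != 0 :> R by rewrite lt0r_neq0.
have densE (G : sgraph 'I_n) : density R C5 G = (10 * nu C5 G)%N%:R / (10 * 'C(n, 5)%:R).
  by rewrite /density !card_ord natrM; field.
have b10 : 0 <= (10 * 'C(n, 5)%:R)^-1 :> R by rewrite invr_ge0 mulr_ge0 // ltW.
apply/andP; split.
  apply: (@le_trans _ _ (density R C5 (turan k n))).
    rewrite densE.
    have -> : (A + - (5 * d ^+ 2 * (2 * d - 1)) * n%:R^-1 + - C * n%:R^-1 ^+ 2) * r n =
      (hom_bound k%:R n%:R - 5 * degenerate_bound k%:R n%:R - C * n%:R ^+ 3)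
        * (10 * 'C(n, 5)%:R)^-1.
      by rewrite /r /A /d /hom_bound /degenerate_bound; field; rewrite kR n0 b0.
    by rewrite ler_wpM2r // turan_ge.
  rewrite /max_density; apply: (le_bigmax_cond _ (fun G : sgraph 'I_n => density R C5 G)).
  by rewrite (turanE n k0) multipartite_free.
have -> : (A + 0 * n%:R^-1 + 0 * n%:R^-1 ^+ 2) * r n =
    hom_bound k%:R n%:R * (10 * 'C(n, 5)%:R)^-1.
  by rewrite /r /A /hom_bound; field; rewrite kR n0 b0.
have up (G : sgraph 'I_n) : Ffree (complete k.+1) G ->
    density R C5 G <= hom_bound k%:R n%:R * (10 * 'C(n, 5)%:R)^-1.
  by move=> GF; rewrite densE ler_wpM2r // nu_le_hom_bound.
(* The default value 0 of the maximum must also lie below the bound, which holds since the density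
   of the Turan graph is nonnegative. *)
apply: bigmax_le => //; apply: le_trans (up (turan k n) _); first by rewrite divr_ge0.
by rewrite (turanE n k0) multipartite_free.
Qed.

End Limit.

Theorem theorem1p4 (R : realType) (k : nat) (hk : (3 <= k)%N) :
  (cvgn (max_density R k C5) /\
   OPT R k C5 = 1 / k%:R ^+ 4 *
     (12 * k%:R ^+ 4 - 60 * k%:R ^+ 3 + 120 * k%:R ^+ 2 - 120 * k%:R + 48)) /\
  (exists N : nat, forall n : nat, (N <= n)%N ->
     [/\ Ffree (complete k.+1) (turan k n),
         nu C5 (turan k n) = extremal n C5 (complete k.+1)
       & forall G : sgraph 'I_n, Ffree (complete k.+1) G ->
           nu C5 G = extremal n C5 (complete k.+1) -> isomorphic G (turan k n)]).
Proof.
have k0 : (0 < k)%N by apply: leq_trans hk.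
split.
  have h := @max_density_cvg R k hk; split; first by apply/cvg_ex; eexists; exact: h.
  exact: cvg_lim h.
have [N0 HN] := extremal_balanced R hk; exists N0 => n Nn.
have turan_free : Ffree (complete k.+1) (turan k n).
  by rewrite (turanE n k0) multipartite_free.
split=> [//||G GF Gext].
  (* Some extremal graph is balanced complete multipartite, and its pentagon count depends only on
     [n] and [k], so the Turan graph attains it. *)
  have [G GF Gext] := extremal_attained C5 turan_free.
  have [c cb GE] := HN n Nn G GF Gext.
  rewrite -Gext GE (turanE n k0); apply/eqP.
  have := etrans (inj5_balanced k0 R cb)
    (esym (inj5_balanced k0 R (@residue_balanced n k k0))).
  by move=> /eqP; rewrite eqr_nat eqn_pmul2l // eq_sym.
have [c cb ->] := HN n Nn G GF Gext; rewrite (turanE n k0).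
exact: balanced_isomorphic cb (@residue_balanced n k k0).
Qed.
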